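(* Let $f$ be an axially monogenic function in a neighbourhood of the origin of $\mathbb{R}^{n+1}$. Then (in a neighbourhood of the origin) $f$ can be written as $$f(x)=\sum_{k=0}^\infty P_k^n(x)\,\frac{f^{(k)}(0)}{k!},\qquad x=x_0+\underline{x}\in\mathbb{R}^{n+1},$$ where $f^{(k)}(0)$ denotes the $k$-th derivative at $x_0=0$ of the restriction $x_0\mapsto f(x_0)$ of $f$ to the real line.
   Context: $\mathbb{R}_n$ is the real Clifford algebra generated by $e_1,\dots,e_n$ with $e_\ell e_m+e_me_\ell=0$ for $\ell\ne m$ and $e_\ell^2=-1$. A point $(x_0,\dots,x_n)\in\mathbb{R}^{n+1}$ is identified with the paravector $x=x_0+\underline{x}$, $\underline{x}=\sum_{\ell=1}^n x_\ell e_\ell$; $\bar x=x_0-\underline{x}$. $\mathbb{S}^{n-1}=\{\underline{x}: x_1^2+\dots+x_n^2=1\}$, and $\mathbb{C}_I=\{u+Iv: u,v\in\mathbb{R}\}$ for $I\in\mathbb{S}^{n-1}$. An axially symmetric slice domain is a domain $U\subseteq\mathbb{R}^{n+1}$ with $U\cap\mathbb{R}\neq\emptyset$, with $U\cap\mathbb{C}_I$ a domain in $\mathbb{C}_I$ for all $I\in\mathbb{S}^{n-1}$, and such that $u+Iv\in U$ for some $I\in\mathbb{S}^{n-1}$ implies $u+Jv\in U$ for all $J\in\mathbb{S}^{n-1}$. A $C^1$ function $f:U\to\mathbb{R}_n$ is (left) monogenic if $\left(\partial_{x_0}+\sum_{i=1}^n e_i\partial_{x_i}\right)f=0$ on $U$.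 It is axially monogenic if $U$ is an axially symmetric slice domain, $f$ is monogenic and $f(x_0+\underline{x})=A(x_0,|\underline{x}|)+\underline{\omega}B(x_0,|\underline{x}|)$, $\underline{\omega}=\underline{x}/|\underline{x}|$, with $\mathbb{R}_n$-valued $A,B$ satisfying $A(u,v)=A(u,-v)$, $B(u,v)=-B(u,-v)$. The Clifford-Appell polynomials are $$P_k^n(x):=\sum_{s=0}^k T_s^k(n)\,x^{k-s}\bar x^{s},\qquad T_s^k(n):=\binom{k}{s}\frac{\left(\frac{n+1}{2}\right)_{k-s}\left(\frac{n-1}{2}\right)_s}{(n)_k},$$ where $(a)_0=1$ and $(a)_s=a(a+1)\cdots(a+s-1)$ for $s>0$. Equivalently, $P_k^n=GCK[x_0^k]$, the unique axially monogenic function on $\mathbb{R}^{n+1}$ whose restriction to the real line is $x_0^k$. *)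

(* Defs.v *)
From HB Require Import structures.
From mathcomp Require Import all_boot all_order all_algebra.
From mathcomp Require Import all_classical all_reals all_analysis.

Set Implicit Arguments.
Unset Strict Implicit.
Unset Printing Implicit Defensive.

Import Order.TTheory GRing.Theory Num.Theory.
Import numFieldNormedType.Exports.

Local Open Scope classical_set_scope.
Local Open Scope ring_scope.

(* The real Clifford algebra with n generators of square -1. An element is the
   row of its 2^n coordinates on the basis of the blades e_A, A : {set 'I_n},
   where e_A is the product of the e_i, i in A, in increasing order of i. *)
Definition clifford (R : realType) (n : nat) : Type := 'rV[R]_#|{set 'I_n}|.

HB.instance Definition _ (R : realType) (n : nat) :=
  NormedModule.copy (clifford R n) 'rV[R]_#|{set 'I_n}|.
HB.instance Definition _ (R : realType) (n : nat) :=
  Uniform_isComplete.Build (clifford R n)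
    (@cauchy_cvg ('rV[R]_#|{set 'I_n}| : completeType)).

Section CliffordAlgebra.
Variables (R : realType) (n : nat).
Implicit Types (A B C : {set 'I_n}) (x y z : clifford R n).

Definition coef A x : R := (x : 'rV[R]__) ord0 (enum_rank A).

Definition blade A : clifford R n :=
  delta_mx ord0 (enum_rank A) : 'rV[R]_#|{set 'I_n}|.

Definition symdiff A B : {set 'I_n} := (A :\: B) :|: (B :\: A).

(* Sorting e_A e_B costs a factor -1 for each swap, i.e. for each pair i in A,
   j in B with j < i, and one more for each cancellation e_i^2 = -1, i.e. for
   each pair with j = i. *)
Definition blade_sign A B : R :=
  \prod_(i in A) \prod_(j in B | (j <= i)%N) (-1).

Definition cl_mul x y : clifford R n :=
  \sum_A \sum_B
    (blade_sign A B * (coef A x * coef B y)) *: blade (symdiff A B).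

Lemma in_symdiff i A B : (i \in symdiff A B) = (i \in A) (+) (i \in B).
Proof. by rewrite !inE; case: (i \in A); case: (i \in B). Qed.

Lemma symdiffA : associative symdiff.
Proof. by move=> A B C; apply/setP => i; rewrite !in_symdiff addbA. Qed.

Lemma symdiff0l : left_id (finset.set0 : {set 'I_n}) symdiff.
Proof. by move=> A; apply/setP => i; rewrite in_symdiff inE. Qed.

Lemma symdiff0r : right_id (finset.set0 : {set 'I_n}) symdiff.
Proof. by move=> A; apply/setP => i; rewrite in_symdiff inE addbF. Qed.

Lemma prod_symdiff (c : 'I_n -> R) A B : (forall i, c i * c i = 1) ->
  \prod_(i in symdiff A B) c i = \prod_(i in A) c i * \prod_(i in B) c i.
Proof.
move=> cc; rewrite big_mkcond [X in _ = X * _]big_mkcond.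
rewrite [X in _ = _ * X]big_mkcond -big_split /=; apply: eq_bigr => i _.
by rewrite in_symdiff; case: (i \in A); case: (i \in B); rewrite ?cc ?mulr1 ?mul1r.
Qed.

Lemma prodN1_sq (P : pred 'I_n) :
  \prod_(j | P j) (-1 : R) * \prod_(j | P j) (-1) = 1.
Proof. by rewrite -big_split big1 //= => i _; rewrite mulrNN mulr1. Qed.

Lemma blade_sign_symdiffl A B C :
  blade_sign (symdiff A B) C = blade_sign A C * blade_sign B C.
Proof. by apply: prod_symdiff => i; exact: prodN1_sq. Qed.

Lemma blade_sign_symdiffr A B C :
  blade_sign A (symdiff B C) = blade_sign A B * blade_sign A C.
Proof.
rewrite /blade_sign -big_split; apply: eq_bigr => i _.
have H (D : {set 'I_n}) : \prod_(j in D | (j <= i)%N) (-1) =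
    \prod_(j in D) (if (j <= i)%N then -1 else 1 : R).
  by rewrite big_mkcondr.
rewrite !H; apply: prod_symdiff => j.
by case: ifP => _; rewrite ?mulrNN mulr1.
Qed.

Lemma blade_sign0l A : blade_sign finset.set0 A = 1.
Proof. by rewrite /blade_sign big_set0. Qed.

Lemma blade_sign0r A : blade_sign A finset.set0 = 1.
Proof.
by rewrite /blade_sign big1 // => i _; rewrite big_pred0 // => j; rewrite inE.
Qed.

Lemma coef_blade A B : coef A (blade B) = (A == B)%:R.
Proof. by rewrite /coef /blade mxE eqxx /= (inj_eq enum_rank_inj). Qed.

Lemma coefD A x y : coef A (x + y) = coef A x + coef A y.
Proof. by rewrite /coef mxE. Qed.

Lemma coefZ A (a : R) x : coef A (a *: x) = a * coef A x.
Proof. by rewrite /coef mxE. Qed.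

Lemma cliffordP x y : (forall A, coef A x = coef A y) -> x = y.
Proof.
move=> H; apply/rowP => i; rewrite -(enum_valK i).
by have := H (enum_val i); rewrite /coef.
Qed.

Lemma cl_sumE x : x = \sum_A coef A x *: blade A.
Proof.
apply: cliffordP => B; pose c := coef B; rewrite -/(c _) -[RHS]/(c _).
have cS : c (\sum_A coef A x *: blade A) = \sum_A c (coef A x *: blade A).
  by apply: big_morph => [u v|]; rewrite /c /coef mxE.
rewrite cS (bigD1 B) //= /c coefZ coef_blade eqxx mulr1.
by rewrite big1 ?addr0 // => A AB; rewrite coefZ coef_blade eq_sym (negbTE AB) mulr0.
Qed.

Lemma cl_mulDl : left_distributive cl_mul +%R.
Proof.
move=> x y z; rewrite /cl_mul -big_split; apply: eq_bigr => A _ /=.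
rewrite -big_split; apply: eq_bigr => B _ /=.
by rewrite -scalerDl coefD mulrDl mulrDr.
Qed.

Lemma cl_mulDr : right_distributive cl_mul +%R.
Proof.
move=> x y z; rewrite /cl_mul -big_split; apply: eq_bigr => A _ /=.
rewrite -big_split; apply: eq_bigr => B _ /=.
by rewrite -scalerDl coefD !mulrDr.
Qed.

Lemma cl_scaleAl (a : R) x y : a *: cl_mul x y = cl_mul (a *: x) y.
Proof.
rewrite /cl_mul scaler_sumr; apply: eq_bigr => A _.
rewrite scaler_sumr; apply: eq_bigr => B _.
by rewrite scalerA coefZ -mulrA mulrCA.
Qed.

Lemma cl_scaleAr (a : R) x y : a *: cl_mul x y = cl_mul x (a *: y).
Proof.
rewrite /cl_mul scaler_sumr; apply: eq_bigr => A _.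
rewrite scaler_sumr; apply: eq_bigr => B _.
by rewrite scalerA coefZ (mulrCA (coef A x)) [a * (blade_sign _ _ * _)]mulrCA.
Qed.

Lemma cl_mul_blade A B :
  cl_mul (blade A) (blade B) = blade_sign A B *: blade (symdiff A B).
Proof.
rewrite /cl_mul (bigD1 A) //= (bigD1 B) //= !coef_blade !eqxx !mulr1.
rewrite big1 ?addr0 => [|D DB]; last first.
  by rewrite coef_blade (negbTE DB) !mulr0 scale0r.
rewrite big1 ?addr0 // => D DA; rewrite big1 // => E _.
by rewrite coef_blade (negbTE DA) mul0r mulr0 scale0r.
Qed.

Lemma cl_mul0l x : cl_mul 0 x = 0.
Proof. by apply: (addIr (cl_mul 0 x)); rewrite -cl_mulDl !add0r. Qed.

Lemma cl_mul0r x : cl_mul x 0 = 0.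
Proof. by apply: (addIr (cl_mul x 0)); rewrite -cl_mulDr !add0r. Qed.

Lemma cl_mul_suml (I : finType) (F : I -> clifford R n) y :
  cl_mul (\sum_i F i) y = \sum_i cl_mul (F i) y.
Proof.
by apply: (big_morph (cl_mul^~ y)) => [u v|]; [exact: cl_mulDl|exact: cl_mul0l].
Qed.

Lemma cl_mul_sumr (I : finType) (F : I -> clifford R n) x :
  cl_mul x (\sum_i F i) = \sum_i cl_mul x (F i).
Proof.
by apply: (big_morph (cl_mul x)) => [u v|]; [exact: cl_mulDr|exact: cl_mul0r].
Qed.

Lemma bilinear_assoc (m : clifford R n -> clifford R n -> clifford R n) :
  left_distributive m +%R -> right_distributive m +%R ->
  (forall a x y, a *: m x y = m (a *: x) y) ->
  (forall a x y, a *: m x y = m x (a *: y)) ->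
  (forall A B C, m (blade A) (m (blade B) (blade C)) =
                 m (m (blade A) (blade B)) (blade C)) ->
  associative m.
Proof.
move=> mDl mDr mZl mZr mA x y z.
have m0l u : m 0 u = 0 by apply: (addIr (m 0 u)); rewrite -mDl !add0r.
have m0r u : m u 0 = 0 by apply: (addIr (m u 0)); rewrite -mDr !add0r.
have ml (F : {set 'I_n} -> clifford R n) v : m (\sum_A F A) v = \sum_A m (F A) v.
  by apply: (big_morph (m^~ v)).
have mr (F : {set 'I_n} -> clifford R n) u : m u (\sum_A F A) = \sum_A m u (F A).
  by apply: (big_morph (m u)).
rewrite (cl_sumE x) !ml; apply: eq_bigr => A _; rewrite -!mZl; congr (_ *: _).
rewrite (cl_sumE y) ml !mr ml; apply: eq_bigr => B _.
rewrite -!(mZl, mZr); congr (_ *: _).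
rewrite (cl_sumE z) !mr; apply: eq_bigr => C _.
by rewrite -!mZr mA.
Qed.

Lemma cl_mulA : associative cl_mul.
Proof.
apply: bilinear_assoc => [||a x y|a x y|A B C].
- exact: cl_mulDl.
- exact: cl_mulDr.
- exact: cl_scaleAl.
- exact: cl_scaleAr.
rewrite !cl_mul_blade -cl_scaleAl -cl_scaleAr !cl_mul_blade !scalerA symdiffA.
rewrite blade_sign_symdiffl blade_sign_symdiffr; congr (_ *: _).
by rewrite mulrC mulrA.
Qed.

Lemma cl_mul1l : left_id (blade finset.set0) cl_mul.
Proof.
move=> x; rewrite [in LHS](cl_sumE x) cl_mul_sumr [RHS]cl_sumE.
apply: eq_bigr => A _.
by rewrite -cl_scaleAr cl_mul_blade blade_sign0l symdiff0l scale1r.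
Qed.

Lemma cl_mul1r : right_id (blade finset.set0) cl_mul.
Proof.
move=> x; rewrite [in LHS](cl_sumE x) cl_mul_suml [RHS]cl_sumE.
apply: eq_bigr => A _.
by rewrite -cl_scaleAl cl_mul_blade blade_sign0r symdiff0r scale1r.
Qed.

Lemma cl_1neq0 : blade finset.set0 != 0.
Proof.
apply/eqP => /(congr1 (coef finset.set0)).
by rewrite coef_blade eqxx /coef mxE => h; have := oner_neq0 R; rewrite -h eqxx.
Qed.

HB.instance Definition _ := GRing.Zmodule_isNzRing.Build (clifford R n)
  cl_mulA cl_mul1l cl_mul1r cl_mulDl cl_mulDr cl_1neq0.
HB.instance Definition _ := GRing.Lmodule_isLalgebra.Build R (clifford R n)
  cl_scaleAl.
HB.instance Definition _ := GRing.Lalgebra_isAlgebra.Build R (clifford R n)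
  cl_scaleAr.

Definition gen (i : 'I_n) : clifford R n := blade [set i]%SET.

Lemma gen_sq i : gen i * gen i = -1.
Proof.
rewrite /gen [LHS]cl_mul_blade /blade_sign.
rewrite big_set1 (big_pred1 i) => [|j]; last first.
  by rewrite /= finset.in_set1 andb_idr // => /eqP ->.
rewrite scaleN1r; congr (- blade _).
by apply/setP => j; rewrite in_symdiff addbb inE.
Qed.

Lemma gen_anticomm i j : i != j -> gen i * gen j + gen j * gen i = 0.
Proof.
move=> ij; rewrite /gen [X in X + _]cl_mul_blade [X in _ + X]cl_mul_blade.
have -> : symdiff [set j]%SET [set i]%SET = symdiff [set i]%SET [set j]%SET.
  by apply/setP => k; rewrite !in_symdiff addbC.
have sgnE k l : blade_sign [set k]%SET [set l]%SET =
    if (l <= k)%N then -1 else 1.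
  rewrite /blade_sign big_set1 big_mkcondr /= big_set1 //.
rewrite -scalerDl !sgnE; case: ltngtP => [_|_|/val_inj ji].
- by rewrite addNr scale0r.
- by rewrite addrN scale0r.
by rewrite ji eqxx in ij.
Qed.

End CliffordAlgebra.

Section AxiallyMonogenic.
Variables (R : realType) (n : nat).

(* A point (x_0, ..., x_n) of R^(n+1) is a row of length 1 + n, with first
   entry x_0 and last n entries the vector part; pt u w is the point u + w. *)
Definition pt (u : R) (w : 'rV[R]_n) : 'rV[R]_(1 + n) := row_mx u%:M w.
Definition re (x : 'rV[R]_(1 + n)) : R := x ord0 ord0.
Definition vec (x : 'rV[R]_(1 + n)) : 'rV[R]_n := rsubmx x.

(* The norm that the library puts on rows is the sup norm. *)
Definition enorm (w : 'rV[R]_n) : R := Num.sqrt (\sum_i w ord0 i ^+ 2).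

Definition cl_vec (w : 'rV[R]_n) : clifford R n :=
  \sum_i w ord0 i *: gen R i.
Definition paravector (x : 'rV[R]_(1 + n)) : clifford R n :=
  (re x)%:A + cl_vec (vec x).
Definition paravector_conj (x : 'rV[R]_(1 + n)) : clifford R n :=
  (re x)%:A - cl_vec (vec x).

Definition sphere : set 'rV[R]_n := [set w | \sum_i w ord0 i ^+ 2 = 1].

Definition real_line : set 'rV[R]_(1 + n) := [set pt u 0 | u in setT].

Definition slice (I : 'rV[R]_n) : set 'rV[R]_(1 + n) :=
  [set x | exists u v : R, x = pt u (v *: I)].

Definition axially_symmetric (U : set 'rV[R]_(1 + n)) : Prop :=
  forall (u v : R) (I J : 'rV[R]_n), sphere I -> sphere J ->
    U (pt u (v *: I)) -> U (pt u (v *: J)).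

Definition axially_symmetric_slice_domain (U : set 'rV[R]_(1 + n)) : Prop :=
  [/\ open U /\ connected U,
      U `&` real_line !=set0,
      forall I, sphere I ->
        open (U `&` slice I : set (subspace (slice I))) /\
        connected (U `&` slice I)
    & axially_symmetric U].

Definition basis_vec (i : 'I_(1 + n)) : 'rV[R]_(1 + n) := delta_mx ord0 i.

Definition C1_on (U : set 'rV[R]_(1 + n)) (f : 'rV[R]_(1 + n) -> clifford R n) :
    Prop :=
  forall (i : 'I_(1 + n)) x, U x ->
    derivable f x (basis_vec i) /\ {for x, continuous ('D_(basis_vec i) f)}.

Definition cauchy_riemann (f : 'rV[R]_(1 + n) -> clifford R n)
    (x : 'rV[R]_(1 + n)) : clifford R n :=
  'D_(basis_vec (lshift n ord0)) f x +
  \sum_(i < n) gen R i * 'D_(basis_vec (rshift 1 i)) f x.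

Definition monogenic (U : set 'rV[R]_(1 + n))
    (f : 'rV[R]_(1 + n) -> clifford R n) : Prop :=
  C1_on U f /\ forall x, U x -> cauchy_riemann f x = 0.

(* On the real line omega is 0 since 0^-1 = 0; its value there is irrelevant
   because B(u, 0) = 0 by oddness. *)
Definition omega (x : 'rV[R]_(1 + n)) : clifford R n :=
  cl_vec ((enorm (vec x))^-1 *: vec x).

Definition axial_form (U : set 'rV[R]_(1 + n))
    (f : 'rV[R]_(1 + n) -> clifford R n) : Prop :=
  exists A B : R -> R -> clifford R n,
    (forall u v I, sphere I -> U (pt u (v *: I)) ->
       A u v = A u (- v) /\ B u v = - B u (- v)) /\
    (forall x, U x ->
       f x = A (re x) (enorm (vec x)) + omega x * B (re x) (enorm (vec x))).

Definition axially_monogenic (U : set 'rV[R]_(1 + n))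
    (f : 'rV[R]_(1 + n) -> clifford R n) : Prop :=
  [/\ axially_symmetric_slice_domain U, monogenic U f & axial_form U f].

Definition restr_real (f : 'rV[R]_(1 + n) -> clifford R n) (t : R) :
    clifford R n := f (pt t 0).

Definition pochhammer (a : R) (s : nat) : R := \prod_(i < s) (a + i%:R).

Definition appell_coef (k s : nat) : R :=
  'C(k, s)%:R * (pochhammer ((n%:R + 1) / 2) (k - s) *
                 pochhammer ((n%:R - 1) / 2) s) / pochhammer n%:R k.

Definition clifford_appell (k : nat) (x : 'rV[R]_(1 + n)) : clifford R n :=
  \sum_(s < k.+1)
    appell_coef k s *: (paravector x ^+ (k - s) * paravector_conj x ^+ s).

End AxiallyMonogenic.

(* Main.v *)
Require Import Defs.
From HB Require Import structures.
From mathcomp Require Import all_boot all_order all_algebra.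
From mathcomp Require Import all_classical all_reals all_analysis.
From mathcomp Require Import ring lra zify.

Set Implicit Arguments.
Unset Strict Implicit.
Unset Printing Implicit Defensive.

Import Order.TTheory GRing.Theory Num.Theory.
Import numFieldNormedType.Exports.

Local Open Scope classical_set_scope.
Local Open Scope ring_scope.

(** Fix a blade and write [a], [b] for the corresponding coordinates of the even
    and odd parts [A], [B] of [f = A + omega B] in a half-plane [u + I v]. With
    [m = n - 1] they solve the Vekua-type system [a_u - b_v = (m / v) b],
    [a_v + b_u = 0]; in polar coordinates [u = r cos t], [v = r sin t] it reads
    [r sin^m a_r = (sin^m b)_t], [r b_r = - a_t - m b]. The Clifford-Appell
    polynomial is [P_k = r^k (a_k(t) + I b_k(t))], where [a_k], [b_k] are trigonometric
    polynomials, and the moments [alpha_k(r)], [beta_k(r)] of [a], [b] against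
    [a_k sin^m], [b_k sin^m] on [[0, pi]] satisfy [r alpha' = (k + m) beta] and
    [r beta' = k alpha - m beta]. The only solutions regular at [0] are multiples
    of [r^k]. Since the [a_k] and the [b_k] are orthogonal and complete, [f] is the
    sum of [P_k c_k] near the origin, with [c_k] at most geometrically large, and
    restricting to the real line, where [P_k = x_0^k], identifies [c_k]. *)

(** * Clifford-Appell coefficients *)

(** [f] is only of class C^1, and the axial form gives no regularity for [A] and [B], so analyticity
    has to come out of the argument. Moments require a single derivative under the integral sign,
    and integration by parts in the angle moves the angular derivatives onto trigonometric
    polynomials; the weight [sin^m] also absorbs the factor [m / v], singular on the real axis. The
    system for the two moments has exponents [k] and [-(k + m)], and the moments are differentiable
    across [r = 0], which excludes the second one. The coefficients [c_k] are moments divided by the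
    weighted square norm of [a_k]. An exponentially small lower bound for that norm is enough: it
    only shrinks the radius, inside which the angular series are dominated by a geometric one,
    converge uniformly, and can be compared with [a] and [b] by integrating term by term. *)

Section AppellCoefficients.
Variable R : realType.
Implicit Types (x y : R) (m k s : nat).

Lemma pochhammerS x s : pochhammer x s.+1 = pochhammer x s * (x + s%:R).
Proof. by rewrite /pochhammer big_ord_recr. Qed.

Lemma pochhammerSl x s : pochhammer x s.+1 = x * pochhammer (x + 1) s.
Proof.
rewrite /pochhammer big_ord_recl addr0; congr (_ * _).
by apply: eq_bigr => i _; rewrite lift0 -natr1 addrAC addrA.
Qed.

Lemma pochhammer_gt0 x s : 0 < x -> 0 < pochhammer x s.
Proof. by move=> x0; apply: prodr_gt0 => i _; rewrite ltr_wpDr. Qed.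

Lemma pochhammer_ge0 x s : 0 <= x -> 0 <= pochhammer x s.
Proof. by move=> x0; apply: prodr_ge0 => i _; rewrite addr_ge0. Qed.

(** Vandermonde's identity for rising factorials. Pascal's rule splits each binomial coefficient,
    and the terms recombine because the new factor [x + y + k] is [(x + (k - s)) + (y + s)]. *)
Lemma pochhammerD x y k :
  \sum_(s < k.+1) 'C(k, s)%:R * (pochhammer x (k - s) * pochhammer y s) =
  pochhammer (x + y) k.
Proof.
elim: k => [|k IH].
  by rewrite big_ord1 /pochhammer !big_ord0 bin0 !mulr1.
pose g s : R := 'C(k, s)%:R * (pochhammer x (k.+1 - s) * pochhammer y s).
pose h s : R := 'C(k, s)%:R * (pochhammer x (k - s) * pochhammer y s.+1).
have -> : \sum_(s < k.+2) 'C(k.+1, s)%:R *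
    (pochhammer x (k.+1 - s) * pochhammer y s) =
    \sum_(s < k.+1) (g s + h s).
  rewrite big_split /= big_ord_recl /= [X in _ = X + _]big_ord_recl /= -addrA.
  rewrite /g !bin0; congr (_ + _).
  have -> : \sum_(i < k) g (bump 0 i) = \sum_(i < k.+1) g i.+1.
    rewrite big_ord_recr /= /g bin_small // mul0r addr0.
    by apply: eq_bigr => i _.
  rewrite -big_split; apply: eq_bigr => i _.
  by rewrite /g /h /= binS natrD mulrDl subSS.
rewrite pochhammerS -IH mulr_suml; apply: eq_bigr => -[s /=]; rewrite ltnS => sk _.
rewrite /g /h subSn // !pochhammerS natrB //; ring.
Qed.

Lemma appell_coefE m k s : @appell_coef R m.+1 k s =
  'C(k, s)%:R * (pochhammer (m%:R / 2 + 1) (k - s) * pochhammer (m%:R / 2) s) /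
  pochhammer m.+1%:R k.
Proof.
rewrite /appell_coef.
have -> : (m.+1%:R + 1) / 2 = m%:R / 2 + 1 :> R by rewrite -natr1; field.
by have -> : (m.+1%:R - 1) / 2 = m%:R / 2 :> R by rewrite -natr1; field.
Qed.

(** Vandermonde's identity with [(m/2 + 1) + m/2 = n]; this is the normalization [P_k(1) = 1]. *)
Lemma appell_coef_sum m k : \sum_(s < k.+1) @appell_coef R m.+1 k s = 1.
Proof.
under eq_bigr do rewrite appell_coefE.
rewrite -mulr_suml pochhammerD.
have -> : m%:R / 2 + 1 + m%:R / 2 = m.+1%:R :> R by rewrite -natr1; field.
by rewrite divff // gt_eqF // pochhammer_gt0.
Qed.

Lemma appell_coef_ge0 m k s : 0 <= @appell_coef R m.+1 k s.
Proof.
rewrite appell_coefE divr_ge0 ?pochhammer_ge0 // mulr_ge0 // mulr_ge0 //.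
  by rewrite pochhammer_ge0 // addr_ge0 // divr_ge0.
by rewrite pochhammer_ge0 // divr_ge0.
Qed.

Lemma appell_coef0_gt0 m k : 0 < @appell_coef R m.+1 k 0.
Proof.
rewrite appell_coefE bin0 mul1r divr_gt0 ?pochhammer_gt0 // mulr_gt0 //.
  by rewrite pochhammer_gt0 // ltr_wpDl // divr_ge0.
by rewrite /pochhammer big_ord0.
Qed.

(** Follows from [(m/2)_j (m + 2j) = m (m/2 + 1)_j]. It makes the sine sums in the differential
    equations below antisymmetric under [s -> k - s], hence zero. *)
Lemma appell_coef_rev m k s : (s <= k)%N ->
  @appell_coef R m.+1 k s * (m%:R + 2 * s%:R) =
  @appell_coef R m.+1 k (k - s) * (m%:R + 2 * (k - s)%:R).
Proof.
move=> sk; rewrite !appell_coefE bin_sub // subKn //.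
have H j : pochhammer (m%:R / 2) j * (m%:R + 2 * j%:R) =
    m%:R * pochhammer (m%:R / 2 + 1) j :> R.
  have := pochhammerSl (m%:R / 2) j; rewrite pochhammerS => E.
  have -> : m%:R + 2 * j%:R = 2 * (m%:R / 2 + j%:R) :> R by field.
  by rewrite mulrCA E; field.
set c := 'C(k, s)%:R; set d := (pochhammer m.+1%:R k)^-1.
transitivity (c * pochhammer (m%:R / 2 + 1) (k - s) * d *
    (pochhammer (m%:R / 2) s * (m%:R + 2 * s%:R))); first by ring.
transitivity (c * pochhammer (m%:R / 2 + 1) s * d *
    (pochhammer (m%:R / 2) (k - s) * (m%:R + 2 * (k - s)%:R))); last by ring.
by rewrite !H; ring.
Qed.

(** Absorbing [s + 1] into the binomial and taking the first factor out of [(m/2)_(s+1)] leaves an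
    expression symmetric in [s] and [k - s]. *)
Lemma appell_coef_shift m k s : (s <= k)%N ->
  s.+1%:R * @appell_coef R m.+1 k.+1 s.+1 =
  (k - s).+1%:R * @appell_coef R m.+1 k.+1 (k - s).+1.
Proof.
move=> sk; rewrite !appell_coefE !subSS subKn // !mulrA -!natrM -!mul_bin_diag.
by rewrite /= bin_sub // !pochhammerSl; ring.
Qed.

(** The reflection at [s = 0] reads [T_0 m = T_k (m + 2k)]. Strictness is what lets [sin (k t)] be
    isolated in [b_k]. *)
Lemma appell_coef_last m k : (0 < k)%N ->
  @appell_coef R m.+1 k k < @appell_coef R m.+1 k 0.
Proof.
move=> k0; have := @appell_coef_rev m k 0 (leq0n k).
rewrite subn0 mulr0 addr0; have := appell_coef0_gt0 m k.
set t0 := appell_coef _ _ _ 0; set tk := appell_coef _ _ _ _ => t0_gt0 E.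
have mk : 0 < m%:R + 2 * k%:R :> R by rewrite ltr_wpDl // mulr_gt0 ?ltr0n.
rewrite -(ltr_pM2r mk) -E ltr_pM2l // ltrDl mulr_gt0 // ltr0n //.
Qed.

End AppellCoefficients.

(** * Angular parts of the Clifford-Appell polynomials *)

Section DeriveSum.
Variables (R : realType) (V W : normedModType R).

Lemma is_derive_fsum n (F : 'I_n -> V -> W) (D : 'I_n -> W) x v :
  (forall i, is_derive x v (F i) (D i)) ->
  is_derive x v (fun y => \sum_(i < n) F i y) (\sum_(i < n) D i).
Proof.
move=> H; have -> : (fun y => \sum_(i < n) F i y) = \sum_(i < n) F i.
  by apply/funext => y; rewrite fct_sumE.
exact: is_derive_sum.
Qed.

End DeriveSum.

Section Angular.
Variable R : realType.
Implicit Types (m k : nat) (t : R).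

(* The functions a_k and b_k: on the half-plane spanned by 1 and a unit vector I,
   P_k (r (cos t + I sin t)) = r^k (a_k t + I b_k t), see clifford_appell_polar. *)
Definition appell_cos m k t : R :=
  \sum_(s < k.+1) appell_coef R m.+1 k s * cos ((k%:R - 2 * s%:R) * t).
Definition appell_sin m k t : R :=
  \sum_(s < k.+1) appell_coef R m.+1 k s * sin ((k%:R - 2 * s%:R) * t).

Lemma is_derive_comp1 (f g : R -> R) (x df dg : R) :
  is_derive x 1 f df -> is_derive (f x) 1 g dg ->
  is_derive x 1 (fun y => g (f y)) (dg * df).
Proof.
move=> [f1 f2] [g1 g2]; apply: DeriveDef.
  by apply/derivable1_diffP/differentiable_comp; exact/derivable1_diffP.
by rewrite -derive1E derive1_comp // !derive1E f2 g2.
Qed.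

Lemma is_derive_scaled (c x : R) : is_derive x 1 (fun y => c * y) c.
Proof. by apply: is_derive_eq; rewrite /GRing.scale /= mulr1. Qed.

Lemma is_derive_cosM (c t : R) :
  is_derive t 1 (fun y => cos (c * y)) (- sin (c * t) * c).
Proof. exact: (is_derive_comp1 (is_derive_scaled c t) (is_derive_cos _)). Qed.

Lemma is_derive_sinM (c t : R) :
  is_derive t 1 (fun y => sin (c * y)) (cos (c * t) * c).
Proof. exact: (is_derive_comp1 (is_derive_scaled c t) (is_derive_sin _)). Qed.

Lemma is_deriveMl (c x df : R) (f : R -> R) : is_derive x 1 f df ->
  is_derive x 1 (fun y => c * f y) (c * df).
Proof. by move=> H; apply: is_derive_eq; rewrite ?scaler0 ?addr0. Qed.

Lemma natrB_rev k (s : 'I_k.+1) : (rev_ord s)%:R = k%:R - s%:R :> R.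
Proof. by rewrite /= subSS natrB // -ltnS. Qed.

(** The termwise derivative differs from the claim by the sum of [T_s (m + 2s) sin ((k - 2s) t)],
    which changes sign under [s -> k - s]. *)
Lemma is_derive_appell_cos m k t :
  is_derive t 1 (appell_cos m k) (- ((k + m)%:R * appell_sin m k t)).
Proof.
have E : is_derive t 1 (appell_cos m k) (\sum_(s < k.+1) appell_coef R m.+1 k s *
    (- sin ((k%:R - 2 * s%:R) * t) * (k%:R - 2 * s%:R))).
  by apply: is_derive_fsum => s; exact/is_deriveMl/is_derive_cosM.
apply: is_derive_eq; rewrite mulr_sumr -sumrN; apply/eqP; rewrite -subr_eq0 -sumrB.
pose F (s : 'I_k.+1) := appell_coef R m.+1 k s * (m%:R + 2 * s%:R) *
  sin ((k%:R - 2 * s%:R) * t).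
rewrite (eq_bigr F) => [|s _]; last by rewrite /F natrD; ring.
have : \sum_s F s = - \sum_s F s.
  rewrite [LHS](reindex_inj rev_ord_inj) /= -sumrN; apply: eq_bigr => s _.
  rewrite /F natrB_rev.
  have sk : (s <= k)%N by rewrite -ltnS.
  rewrite /= subSS (appell_coef_rev R m sk) natrB // -[RHS]mulrN -[in RHS]sinN.
  by congr (_ * sin _); ring.
by move=> FN; apply/eqP; lra.
Qed.

Definition appell_sin_der m k t : R := \sum_(s < k.+1)
  appell_coef R m.+1 k s * (cos ((k%:R - 2 * s%:R) * t) * (k%:R - 2 * s%:R)).

Lemma is_derive_appell_sin m k t :
  is_derive t 1 (appell_sin m k) (appell_sin_der m k t).
Proof. by apply: is_derive_fsum => s; exact/is_deriveMl/is_derive_sinM. Qed.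

Lemma sum_rev_opp k (F : 'I_k.+1 -> R) :
  (forall s : 'I_k.+1, F (rev_ord s) = - F s) -> \sum_s F s = 0.
Proof.
move=> FN; have : \sum_s F s = - \sum_s F s.
  rewrite [LHS](reindex_inj rev_ord_inj) /= -sumrN.
  by apply: eq_bigr => s _; exact: FN.
by move=> H; lra.
Qed.

(** Stated without dividing by [sin t], so that it holds at the poles. Product-to-sum formulas write
    the difference of the two sides as sums [F] and [G] of sines; [F] is antisymmetric under
    reversal, and so is [G] once its null term [s = 0] is dropped. *)
Lemma appell_sin_ode m k t :
  sin t * appell_sin_der m k t + m%:R * cos t * appell_sin m k t =
  k%:R * sin t * appell_cos m k t.
Proof.
apply/eqP; rewrite -subr_eq0 !mulr_sumr -big_split /= -sumrB.
pose j (s : 'I_k.+1) : R := k%:R - 2 * s%:R.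
pose T (s : 'I_k.+1) := appell_coef R m.+1 k s.
pose F (s : 'I_k.+1) := T s * (m%:R + 2 * s%:R) * (sin ((j s - 1) * t) + sin ((j s + 1) * t)).
pose G (s : 'I_k.+1) := s%:R * T s * sin ((j s + 1) * t).
rewrite (eq_bigr (fun s => 2^-1 * F s - 2 * G s)) => [|s _]; last first.
  rewrite -/(j s) -/(T s) /F /G.
  have -> : (j s - 1) * t = j s * t - t by ring.
  have -> : (j s + 1) * t = j s * t + t by ring.
  rewrite sinB sinD.
  rewrite (_ : k%:R = j s + 2 * s%:R); last by rewrite /j subrK.
  by field.
rewrite sumrB -!mulr_sumr sum_rev_opp => [|s]; last first.
  have sk : (s <= k)%N by rewrite -ltnS.
  rewrite /F /T /j natrB_rev /= subSS (appell_coef_rev R m sk) natrB // -[RHS]mulrN.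
  congr (_ * _); rewrite opprD -2!sinN addrC.
  by congr (sin _ + sin _); ring.
suff -> : \sum_s G s = 0 by rewrite !mulr0 subr0.
rewrite /G /T /j {j T F G}; case: k => [|k]; first by rewrite big_ord1 !mul0r.
rewrite big_ord_recl /= !mul0r add0r sum_rev_opp // => s.
have sk : (s <= k)%N by rewrite -ltnS.
rewrite /bump /= !add1n subSS -(appell_coef_shift R m sk) -[RHS]mulrN -[in RHS]sinN.
by congr (_ * sin _); rewrite -!natr1 natrB //; ring.
Qed.

(** For [n = 1] only the power [x^k] survives, because [(0)_s = 0] for [s > 0]. *)
Lemma appell_coef_00 m k : m = 0%N -> forall s, (0 < s)%N -> (s <= k)%N ->
  appell_coef R m.+1 k s = 0.
Proof.
move=> -> [//|s] _ sk; rewrite appell_coefE [pochhammer (0 / 2) _]pochhammerSl.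
by rewrite !mul0r !mulr0 mul0r.
Qed.

Lemma is_derive_weighted_appell_sin m k t :
  is_derive t 1 (fun x => sin x ^+ m * appell_sin m k x)
    (k%:R * (sin t ^+ m * appell_cos m k t)).
Proof.
have H := is_derive_appell_sin m k t.
have E := appell_sin_ode m k t.
case: m => [|m] in H E *.
  have -> : (fun x => sin x ^+ 0 * appell_sin 0 k x) = appell_sin 0 k.
    by apply/funext => x; rewrite expr0 mul1r.
  apply: is_derive_eq; rewrite expr0 mul1r mulr_sumr; apply: eq_bigr => -[s sk] _ /=.
  case: s sk => [|s] sk; first by rewrite mulr0 subr0; ring.
  by rewrite (@appell_coef_00 0 k erefl s.+1) ?mul0r ?mulr0.
have P : is_derive t 1 (fun x => sin x ^+ m.+1) (m.+1%:R * sin t ^+ m * cos t).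
  have -> : (fun x => sin x ^+ m.+1) = @sin R ^+ m.+1.
    by apply/funext => x; rewrite exprfctE.
  by apply: is_derive_eq; rewrite /GRing.scale.
apply: is_derive_eq; rewrite /GRing.scale /=.
transitivity (sin t ^+ m * (k%:R * sin t * appell_cos m.+1 k t)).
  by rewrite -E exprS; ring.
by rewrite exprS; ring.
Qed.

(** The coefficients are nonnegative of sum [1], so this is a convex combination of values of
    [g]. *)
Lemma norm_appell_le (g : R -> R) m k t : (forall x, `|g x| <= 1) ->
  `|\sum_(s < k.+1) appell_coef R m.+1 k s * g ((k%:R - 2 * s%:R) * t)| <= 1.
Proof.
move=> g1; rewrite -(appell_coef_sum R m k).
apply: le_trans (ler_norm_sum _ _ _) _; apply: ler_sum => s _.
by rewrite normrM ger0_norm ?appell_coef_ge0 // ler_piMr ?appell_coef_ge0.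
Qed.

Lemma norm_appell_cos_le1 m k t : `|appell_cos m k t| <= 1.
Proof. exact/norm_appell_le/cos_max. Qed.

Lemma norm_appell_sin_le1 m k t : `|appell_sin m k t| <= 1.
Proof. exact/norm_appell_le/sin_max. Qed.

Lemma appell_cos0 m k : appell_cos m k 0 = 1.
Proof.
rewrite -(appell_coef_sum R m k); apply: eq_bigr => s _.
by rewrite mulr0 cos0 mulr1.
Qed.

Lemma appell_sin0 m k : appell_sin m k 0 = 0.
Proof. by apply: big1 => s _; rewrite mulr0 sin0 mulr0. Qed.

Lemma sin_natrpi k : sin (k%:R * pi) = 0 :> R.
Proof.
elim: k => [|k IH]; first by rewrite mul0r sin0.
by rewrite -natr1 mulrDl mul1r sinDpi IH oppr0.
Qed.

Lemma appell_sinpi m k : appell_sin m k pi = 0.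
Proof.
apply: big1 => s _; rewrite mulrBl -natrM sinB !sin_natrpi.
by rewrite mul0r mulr0 subrr mulr0.
Qed.

Lemma appell_sin_0 m t : appell_sin m 0 t = 0.
Proof. by rewrite /appell_sin big_ord1 mulr0 subrr mul0r sin0 mulr0. Qed.

Section Span.
Variable P : (R -> R) -> Prop.
Hypothesis Plin : forall c d f g, P f -> P g -> P (fun t => c * f t + d * g t).

(** [P] stands for membership in a linear subspace; the given member [g] puts the zero function, the
    empty sum, in [P]. *)
Lemma span_sum n (c : 'I_n -> R) (f : 'I_n -> R -> R) g : P g ->
  (forall i, P (f i)) -> P (fun t => \sum_(i < n) c i * f i t).
Proof.
move=> Pg; elim: n => [|n IH] in c f * => Pf.
  have := Plin 0 0 Pg Pg; congr P; apply/funext => t.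
  by rewrite big_ord0 !mul0r addr0.
have := Plin 1 (c ord_max) (IH (fun i => c (widen_ord (leqnSn n) i)) _
  (fun i => Pf (widen_ord (leqnSn n) i))) (Pf ord_max).
by congr P; apply/funext => t; rewrite big_ord_recr /= mul1r.
Qed.

(** The system is triangular: in [a_k] the terms [s = 0] and [s = k] both give [cos (k t)], with
    total coefficient [T_0 + T_k > 0], and all other frequencies are smaller in absolute value. *)
Lemma cos_span m : (forall k, P (appell_cos m k)) ->
  forall k, P (fun t => cos (k%:R * t)).
Proof.
move=> Pa k; elim/ltn_ind: k => -[|k] IH.
  have := Pa 0%N; congr P; apply/funext => t.
  have := appell_coef_sum R m 0; rewrite big_ord1 => E.
  by rewrite /appell_cos big_ord1 E mul1r mulr0 subr0.
have Pmid (i : 'I_k) : P (fun t => cos ((k.+1%:R - 2 * i.+1%:R) * t)).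
  have ik := ltn_ord i; case: (leqP (2 * i.+1)%N k.+1) => ik2.
    have := IH (k.+1 - 2 * i.+1)%N; rewrite natrB // natrM; apply; lia.
  have ik1 : (2 * i.+1 - k.+1 < k.+1)%N by lia.
  have := IH _ ik1; rewrite natrB ?natrM; last exact: ltnW.
  by congr P; apply/funext => t; rewrite -cosN; congr cos; ring.
pose T s := appell_coef R m.+1 k.+1 s.
have T0 : T 0%N + T k.+1 != 0.
  by rewrite gt_eqF // ltr_pwDl ?appell_coef0_gt0 ?appell_coef_ge0.
have := Plin (T 0%N + T k.+1)^-1 (- (T 0%N + T k.+1)^-1) (Pa k.+1)
  (span_sum (fun i => T i.+1) (Pa 0%N) Pmid).
congr P; apply/funext => t.
rewrite /appell_cos big_ord_recl big_ord_recr /= -/(T _) -/(T _).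
under eq_bigr do rewrite /bump /= add1n.
rewrite mulr0 subr0 -/(T _).
have -> : cos ((k.+1%:R - 2 * k.+1%:R) * t) = cos (k.+1%:R * t).
  by rewrite -cosN; congr cos; ring.
by set S := \sum_(i < k) _; field.
Qed.

(** As for cosines, except that the two extreme terms have opposite signs, so the leading
    coefficient is [T_0 - T_k]. *)
Lemma sin_span m : (forall k, P (appell_sin m k)) ->
  forall k, P (fun t => sin (k%:R * t)).
Proof.
move=> Pa k; elim/ltn_ind: k => -[|k] IH.
  have := Pa 0%N; congr P; apply/funext => t.
  by rewrite appell_sin_0 mul0r sin0.
have Pmid (i : 'I_k) : P (fun t => sin ((k.+1%:R - 2 * i.+1%:R) * t)).
  have ik := ltn_ord i; case: (leqP (2 * i.+1)%N k.+1) => ik2.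
    have := IH (k.+1 - 2 * i.+1)%N; rewrite natrB // natrM; apply; lia.
  have ik1 : (2 * i.+1 - k.+1 < k.+1)%N by lia.
  have := Plin (-1) 0 (IH _ ik1) (IH _ ik1); rewrite natrB ?natrM; last exact: ltnW.
  congr P; apply/funext => t; rewrite mul0r addr0 mulN1r -sinN; congr sin; ring.
pose T s := appell_coef R m.+1 k.+1 s.
have T0 : T 0%N - T k.+1 != 0 by rewrite gt_eqF // subr_gt0 appell_coef_last.
have := Plin (T 0%N - T k.+1)^-1 (- (T 0%N - T k.+1)^-1) (Pa k.+1)
  (span_sum (fun i => T i.+1) (Pa 0%N) Pmid).
congr P; apply/funext => t.
rewrite /appell_sin big_ord_recl big_ord_recr /= -/(T _) -/(T _).
under eq_bigr do rewrite /bump /= add1n.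
rewrite mulr0 subr0 -/(T _).
have -> : sin ((k.+1%:R - 2 * k.+1%:R) * t) = - sin (k.+1%:R * t).
  by rewrite -sinN; congr sin; ring.
by set S := \sum_(i < k) _; field.
Qed.

End Span.

End Angular.

(** * Integrals over a segment *)

Section SegmentIntegral.
Variable R : realType.
Implicit Types (a b c : R) (f g F : R -> R).

Lemma continuousMr f g : continuous f -> continuous g ->
  continuous (fun x => f x * g x).
Proof. by move=> cf cg x; exact: (cvgM (cf x) (cg x)). Qed.

Lemma continuousMl c f : continuous f -> continuous (fun x => c * f x).
Proof. by move=> cf; apply: continuousMr => // x; exact: cvg_cst. Qed.

Lemma continuousDr f g : continuous f -> continuous g ->
  continuous (fun x => f x + g x).
Proof. by move=> cf cg x; exact: (cvgD (cf x) (cg x)). Qed.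

Lemma is_derive_continuous F f : (forall x : R, is_derive x 1 F (f x)) -> continuous F.
Proof.
by move=> dF x; apply/differentiable_continuous/derivable1_diffP; case: (dF x).
Qed.

Definition segint a b f : R := \int[lebesgue_measure]_(x in `[a, b]) f x.

Lemma segint_integrable a b f : continuous f ->
  lebesgue_measure.-integrable `[a, b] (EFin \o f).
Proof.
move=> cf; apply: continuous_compact_integrable; first exact: segment_compact.
exact: continuous_subspaceT.
Qed.

Lemma eq_segint a b f g : (forall x, a <= x <= b -> f x = g x) ->
  segint a b f = segint a b g.
Proof. by move=> fg; apply: eq_Rintegral => x; rewrite inE /= in_itv => /fg. Qed.

Lemma segint_lin a b c d f g : continuous f -> continuous g ->
  segint a b (fun x => c * f x + d * g x) = c * segint a b f + d * segint a b g.
Proof.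
move=> cf cg; rewrite /segint RintegralD ?RintegralZl //; try exact: segint_integrable.
  by apply: segint_integrable; exact: continuousMl.
by apply: segint_integrable; exact: continuousMl.
Qed.

Lemma segintZ a b c f : continuous f ->
  segint a b (fun x => c * f x) = c * segint a b f.
Proof.
move=> cf; rewrite -[RHS]addr0 -(mul0r (segint a b f)) -segint_lin //.
by apply: eq_segint => x _; rewrite mul0r addr0.
Qed.

Lemma segint_cst a b c : a <= b -> segint a b (fun=> c) = c * (b - a).
Proof.
move=> ab; rewrite /segint Rintegral_cst //=.
by rewrite lebesgue_measure_itv /= lte_fin; case: ltgtP ab => //= -> _; rewrite subrr.
Qed.

Lemma le_segint a b f g : continuous f -> continuous g ->
  (forall x, a <= x <= b -> f x <= g x) -> segint a b f <= segint a b g.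
Proof.
move=> cf cg fg; by apply: le_Rintegral => //; exact: segint_integrable.
Qed.

Lemma segint_ge0 a b f : (forall x, a <= x <= b -> 0 <= f x) -> 0 <= segint a b f.
Proof. by move=> f0; apply: Rintegral_ge0 => x /=; rewrite in_itv => /f0. Qed.

Lemma norm_segint_le a b f g : a <= b -> continuous f -> continuous g ->
  (forall x, a <= x <= b -> `|f x| <= g x) -> `|segint a b f| <= segint a b g.
Proof.
move=> ab cf cg fg; rewrite ler_norml; apply/andP; split; last first.
  by apply: le_segint => // x /fg; rewrite ler_norml => /andP[].
rewrite -mulN1r -segintZ //; apply: le_segint => // [|x /fg].
  exact: continuousMl.
by rewrite mulN1r ler_norml => /andP[].
Qed.

Lemma segint_split a b c f : continuous f -> a <= c -> c <= b ->
  segint a b f = segint a c f + segint c b f.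
Proof.
move=> cf ac cb; have ib := @segint_integrable a b f cf.
have := Rintegral_itvB ib (x := c); rewrite !bnd_simp => /(_ ac cb) E.
apply/eqP; rewrite addrC -subr_eq /segint E.
rewrite Rintegral_itv_obnd_cbnd //.
apply: integrableS (segint_integrable c b cf) => //.
by move=> x /=; rewrite !in_itv /= => /andP[/ltW -> ->].
Qed.

Lemma segint_FTC a b f F : a < b -> continuous f ->
  (forall x : R, is_derive x 1 F (f x)) -> segint a b f = F b - F a.
Proof.
move=> ab cf dF; rewrite /segint /Rintegral (continuous_FTC2 ab (F := F)) //.
- exact: continuous_subspaceT.
- have cF := is_derive_continuous dF.
  split => [x _||]; first by case: (dF x).
  + by apply: cvg_at_right_filter; exact: cF.
  + by apply: cvg_at_left_filter; exact: cF.
- by move=> x _; rewrite derive1E; case: (dF x).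
Qed.

Lemma segint_by_parts a b f g F G : a < b -> continuous f -> continuous g ->
  (forall x : R, is_derive x 1 F (f x)) -> (forall x : R, is_derive x 1 G (g x)) ->
  segint a b (fun x => F x * g x) =
  F b * G b - F a * G a - segint a b (fun x => f x * G x).
Proof.
move=> ab cf cg dF dG.
have cF := is_derive_continuous dF; have cG := is_derive_continuous dG.
have cFg := continuousMr cF cg; have cfG := continuousMr cf cG.
have : segint a b (fun x => 1 * (F x * g x) + 1 * (f x * G x)) =
    F b * G b - F a * G a.
  apply: (@segint_FTC a b _ (fun x => F x * G x)) => // [|x].
    by apply: continuousDr; exact: continuousMl.
  have := dF x; have := dG x => dGx dFx.
  by apply: is_derive_eq; rewrite /GRing.scale /= !mul1r [G x * _]mulrC.
by rewrite segint_lin // !mul1r => <-; rewrite addrK.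
Qed.

End SegmentIntegral.

(** * Completeness of the cosines *)

Section CosineCompleteness.
Variable R : realType.
Implicit Types (s t : R) (h phi : R -> R).

Lemma bernoulli_ineq (x : R) N : 0 <= x -> 1 + N%:R * x <= (1 + x) ^+ N.
Proof.
move=> x0; elim: N => [|N IH]; first by rewrite mul0r addr0 expr0.
rewrite exprS; apply: le_trans (ler_wpM2l _ IH); last by rewrite addr_ge0.
rewrite -natr1; have : 0 <= N%:R * x * x by rewrite !mulr_ge0.
by move=> ?; lra.
Qed.

Lemma continuous_cosM (c : R) : continuous (fun t => cos (c * t)).
Proof. by apply: is_derive_continuous => t; exact: is_derive_cosM. Qed.

Lemma cosM_cos s t : cos s * cos t = 2^-1 * (cos (s + t) + cos (s - t)) :> R.
Proof. by rewrite cosD cosB; field. Qed.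

Section Test.
Variable h : R -> R.
Hypothesis ch : continuous h.

(** The multipliers [phi] for which [h * phi] is orthogonal to every cosine. They form a space
    stable under multiplication by [cos], hence by polynomials in [cos]. *)
Definition cos_orth phi := continuous phi /\
  forall k, segint 0 pi (fun t => h t * phi t * cos (k%:R * t)) = 0.

Lemma cos_orth_cont k phi : continuous phi ->
  continuous (fun t => h t * phi t * cos (k%:R * t)).
Proof. by move=> cp; exact: continuousMr (continuousMr ch cp) (@continuous_cosM _). Qed.

Lemma cos_orth_lin (c d : R) phi psi : cos_orth phi -> cos_orth psi ->
  cos_orth (fun t => c * phi t + d * psi t).
Proof.
move=> [cp p0] [cq q0]; split=> [|k].
  by apply: continuousDr; exact: continuousMl.
transitivity (segint 0 pi (fun t => c * (h t * phi t * cos (k%:R * t)) +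
    d * (h t * psi t * cos (k%:R * t)))).
  by apply: eq_segint => t _; ring.
by rewrite segint_lin ?p0 ?q0 ?mulr0 ?addr0 //; exact: cos_orth_cont.
Qed.

Lemma cos_orth_cos phi : cos_orth phi -> cos_orth (fun t => cos t * phi t).
Proof.
move=> [cp p0]; split=> [|k]; first exact: (continuousMr (@continuous_cos R) cp).
(* The boolean factors choose between [cos ((k - 1) t)] for [k > 0] and [cos t] for [k = 0], where
   the frequency [-1] is not a natural number. *)
transitivity (segint 0 pi (fun t => 2^-1 * (h t * phi t * cos (k.+1%:R * t)) +
    2^-1 * (h t * phi t * cos (k.-1%:R * t) * (k != 0%N)%:R +
            h t * phi t * cos (1%:R * t) * (k == 0%N)%:R))).
  apply: eq_segint => t _.
  transitivity (h t * phi t * (cos (k%:R * t) * cos t)); first by ring.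
  rewrite cosM_cos; have -> : k%:R * t + t = k.+1%:R * t by rewrite -natr1; ring.
  case: k => [|k] /=; first by rewrite mul0r sub0r cosN !mul1r; ring.
  have -> : k.+1%:R * t - t = k%:R * t by rewrite -natr1; ring.
  by ring.
rewrite segint_lin; [|exact: cos_orth_cont|].
  rewrite p0 mulr0 add0r; case: k => [|k] /=.
    by under eq_segint do rewrite mulr0 mulr1 add0r; rewrite p0 mulr0.
  by under eq_segint do rewrite mulr0 mulr1 addr0; rewrite p0 mulr0.
by apply: continuousDr; apply: continuousMr; try exact: cos_orth_cont;
  move=> ?; exact: cvg_cst.
Qed.

Lemma cos_orth_pow (c t0 : R) N : cos_orth (fun=> 1) ->
  cos_orth (fun t => (c - (cos t - t0) ^+ 2 / 4) ^+ N).
Proof.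
move=> o1; elim: N => [|N IH].
  by have -> : (fun t : R => (c - (cos t - t0) ^+ 2 / 4) ^+ 0) = (fun=> 1).
set phi := (fun t : R => _) in IH.
have o2 := cos_orth_lin (c - t0 ^+ 2 / 4) (t0 / 2) IH (cos_orth_cos IH).
have := cos_orth_lin 1 (- 4^-1) o2 (cos_orth_cos (cos_orth_cos IH)).
by congr cos_orth; apply/funext => t; rewrite [RHS]exprS -/(phi t); move: (phi t) => u; field.
Qed.

(* If h s > 0, test h against high powers of 1 + eta - (cos t - cos s)^2 / 4,
   which exceed 1 near s and stay in [0, 1] away from s. *)
Lemma cos_orth_nonpos s : cos_orth (fun=> 1) -> 0 < s < pi -> h s <= 0.
Proof.
move=> o1 /andP[s0 spi]; rewrite leNgt; apply/negP => hs.
have [d [d0 ds dpi hd]] : exists d, [/\ 0 < d, d <= s, d <= pi - s &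
    forall t, `|t - s| < d -> h s / 2 < h t].
  have /cvgrPdist_lt /(_ _ (divr_gt0 hs (ltr0Sn _ 1))) := @ch s.
  move=> /nbhs_ballP[d /= d0 hd]; exists (Num.min d (Num.min s (pi - s))).
  split; rewrite ?lt_min ?ge_min ?lexx ?orbT //.
    by rewrite d0 s0 subr_gt0.
  move=> t; rewrite !lt_min => /and3P[td _ _].
  have /hd /= : ball s d t by rewrite /ball /= distrC.
  by rewrite ltr_norml => /andP[_]; lra.
have sI : s \in `[0, pi] by rewrite in_itv /= !ltW.
have dI1 : s - d \in `[0, pi] by rewrite in_itv /=; apply/andP; split; lra.
have dI2 : s + d \in `[0, pi] by rewrite in_itv /=; apply/andP; split; lra.
(* Since [cos] decreases on [[0, pi]], it moves by at least [de] as soon as [t] leaves the window of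
   radius [d]. *)
pose de := Num.min (cos (s - d) - cos s) (cos s - cos (s + d)).
have de0 : 0 < de.
  by rewrite lt_min !subr_gt0 !ltr_cos // ltrBlDr ltrDl d0.
have [e [e0 ed he]] : exists e, [/\ 0 < e, e < d &
    forall t, s <= t <= s + e -> `|cos t - cos s| < de / 2].
  have /cvgrPdist_lt /(_ _ (divr_gt0 de0 (ltr0Sn _ 1))) := @continuous_cos R s.
  move=> /nbhs_ballP[e /= e0 he]; exists (Num.min e d / 2).
  have m0 : 0 < Num.min e d by rewrite lt_min e0 d0.
  have : Num.min e d <= d by rewrite ge_min lexx orbT.
  have : Num.min e d <= e by rewrite ge_min lexx.
  split; [lra|lra|move=> t /andP[st ts]].
  rewrite distrC; apply: he; rewrite /ball /= distrC ger0_norm; lra.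
(* Outside the window the square is at least [de^2], so [q <= 1]; on [[s, s + e]] it is at most
   [de^2 / 4], so [q >= 1 + de^2 / 8]. *)
pose q t := (1 + de ^+ 2 / 4) - (cos t - cos s) ^+ 2 / 4.
have q_ge0 t : 0 <= q t.
  have : (cos t - cos s) ^+ 2 <= 4.
    rewrite -[4]/(2 * 2)%:R natrM -expr2 -[leLHS]real_normK ?num_real //.
    rewrite lerXn2r ?nnegrE // (le_trans (ler_normB _ _)) //.
    by have := cos_max t; have := cos_max s; lra.
  by rewrite /q; have := sqr_ge0 de; lra.
have out t : 0 <= t <= pi -> d <= `|t - s| -> q t <= 1.
  move=> tI dt; have tI' : t \in `[0, pi] by rewrite in_itv.
  suff : de ^+ 2 <= (cos t - cos s) ^+ 2 by rewrite /q; lra.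
  rewrite -[leRHS]real_normK ?num_real // lerXn2r ?nnegrE ?(ltW de0) //.
  move: dt; rewrite ler_normr => /orP[dt|dt].
    have : cos t <= cos (s + d) by rewrite leNgt ltr_cos // -leNgt; lra.
    have : de <= cos s - cos (s + d) by rewrite /de ge_min lexx orbT.
    by move=> ? ?; rewrite ler_normr; apply/orP; right; lra.
  have : cos (s - d) <= cos t by rewrite leNgt ltr_cos // -leNgt; lra.
  have : de <= cos (s - d) - cos s by rewrite /de ge_min lexx.
  by move=> ? ?; rewrite ler_normr; apply/orP; left; lra.
have inn t : s <= t <= s + e -> 1 + de ^+ 2 / 8 <= q t.
  move=> /he ht; have : (cos t - cos s) ^+ 2 <= (de / 2) ^+ 2.
    rewrite -[leLHS]real_normK ?num_real // lerXn2r ?nnegrE ?(ltW ht) //.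
    by rewrite divr_ge0 ?(ltW de0).
  by rewrite exprMn /q; have := sqr_ge0 de; lra.
have low N t : 0 <= t <= pi -> - `|h t| <= h t * q t ^+ N.
  move=> tI; have [/hd ht|/(out _ tI) qt] := ltP `|t - s| d.
    apply: (@le_trans _ _ 0); first by rewrite oppr_le0.
    by rewrite mulr_ge0 ?exprn_ge0 //; lra.
  have : `|h t * q t ^+ N| <= `|h t|.
    by rewrite normrM ler_piMr // normrX ger0_norm // exprn_ile1.
  by rewrite ler_norml => /andP[].
have cq N : continuous (fun t => h t * q t ^+ N).
  by apply: continuousMr => //; case: (cos_orth_pow (1 + de ^+ 2 / 4) (cos s) N o1).
have cN : continuous (fun t => - `|h t|).
  by move=> t; apply: cvgN; apply: cvg_norm; exact: ch.
(* A lower bound, independent of [N], for the contribution of the complement of [[s, s + e]]: inside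
   the window [h] is positive, outside it [q^N <= 1]. *)
pose C := segint 0 s (fun t => - `|h t|) + segint (s + e) pi (fun t => - `|h t|).
have key N : C + h s / 2 * (1 + de ^+ 2 / 8) ^+ N * e <= 0.
  have [_ /(_ 0%N)] := cos_orth_pow (1 + de ^+ 2 / 4) (cos s) N o1.
  under eq_segint do rewrite mul0r cos0 mulr1.
  rewrite (segint_split (cq N) (c := s)) ?(ltW s0) ?(ltW spi) //.
  rewrite (segint_split (a := s) (cq N) (c := s + e)); [|lra|lra].
  move=> E; rewrite -[leRHS]E /C addrAC -addrA; apply: lerD.
    by apply: le_segint => // t /andP[t0 ts]; apply: low; lra.
  apply: lerD; last by apply: le_segint => // t /andP[t0 ts]; apply: low; lra.
  have -> : h s / 2 * (1 + de ^+ 2 / 8) ^+ N * e =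
      segint s (s + e) (fun=> h s / 2 * (1 + de ^+ 2 / 8) ^+ N).
    by rewrite segint_cst; [congr (_ * _); ring|lra].
  apply: le_segint => // [t|t tI]; first exact: cvg_cst.
  apply: ler_pM; [lra|by rewrite exprn_ge0 // addr_ge0 // divr_ge0 // sqr_ge0| |].
    by apply/ltW/hd; case/andP: tI => *; rewrite ger0_norm; lra.
  apply: lerXn2r; rewrite ?nnegrE ?q_ge0 ?inn //.
  by rewrite addr_ge0 // divr_ge0 // sqr_ge0.
(* By Bernoulli's inequality the contribution of [[s, s + e]] grows at least like [N c], which
   contradicts [key] once [N c > |C|]. *)
pose c := h s / 2 * (de ^+ 2 / 8) * e.
have c0 : 0 < c by rewrite !mulr_gt0 ?invr_gt0 // exprn_gt0.
have := archi_boundP (normr_ge0 (C / c)); set N := Num.bound _; clearbody N.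
rewrite normrM normfV (gtr0_norm c0) ltr_pdivrMr // => CN.
have := key N; have := @bernoulli_ineq (de ^+ 2 / 8) N.
have /[swap]/[apply] : 0 <= de ^+ 2 / 8 by rewrite divr_ge0 // sqr_ge0.
have hse : 0 < h s / 2 * e by rewrite mulr_gt0 ?divr_gt0.
rewrite -(ler_pM2l hse) => B K.
have : h s / 2 * e * (1 + N%:R * (de ^+ 2 / 8)) = h s / 2 * e + N%:R * c.
  by rewrite /c; ring.
have : h s / 2 * e * (1 + de ^+ 2 / 8) ^+ N =
    h s / 2 * (1 + de ^+ 2 / 8) ^+ N * e by rewrite mulrAC.
move=> E1 E2; rewrite E1 E2 in B.
have : - `|C| <= C by rewrite lerNl -normrN ler_norm.
by lra.
Qed.

End Test.

Lemma cos_complete h : continuous h ->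
  (forall k, segint 0 pi (fun t => h t * cos (k%:R * t)) = 0) ->
  forall t, 0 < t < pi -> h t = 0.
Proof.
move=> ch h0 t tI; apply/eqP; rewrite eq_le cos_orth_nonpos //=; last first.
  split=> [?|k]; first exact: cvg_cst.
  by under eq_segint do rewrite mulr1.
have chN : continuous (fun t => -1 * h t) by exact: continuousMl.
have := @cos_orth_nonpos _ chN t; rewrite mulN1r oppr_le0; apply => //.
split=> [?|k]; first exact: cvg_cst.
under eq_segint do rewrite mulr1 -mulrA.
by rewrite segintZ ?h0 ?mulr0 //; apply: continuousMr => //; exact: (@continuous_cosM _).
Qed.

Lemma eq0_right_limit (h : R -> R) (a e : R) : 0 < e -> {for a, continuous h} ->
  (forall t, a < t < a + e -> h t = 0) -> h a = 0.
Proof.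
move=> e0 ch h0; apply/eqP; rewrite -normr_le0 leNgt; apply/negP => ha.
have /cvgrPdist_lt /(_ _ ha) /nbhs_ballP[d /= d0 hd] := ch.
pose t := a + Num.min d e / 2.
have m0 : 0 < Num.min d e by rewrite lt_min d0 e0.
have md : Num.min d e <= d by rewrite ge_min lexx.
have me : Num.min d e <= e by rewrite ge_min lexx orbT.
have /hd : ball a d t by rewrite /ball /= distrC /t addrAC subrr add0r ger0_norm; lra.
have tI : a < t < a + e by rewrite /t; lra.
by rewrite (h0 _ tI) subr0 ltxx.
Qed.

Lemma eq0_left_limit (h : R -> R) (a e : R) : 0 < e -> {for a, continuous h} ->
  (forall t, a - e < t < a -> h t = 0) -> h a = 0.
Proof.
move=> e0 ch h0; have := @eq0_right_limit (fun t => h (- t)) (- a) e e0.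
rewrite opprK; apply => [|t tI]; last by apply: h0; lra.
apply: (@continuous_comp _ _ _ -%R h); first exact: opp_continuous.
by rewrite opprK.
Qed.

End CosineCompleteness.

(** * A chain rule for functions of two real variables *)

Section PlanarCalculus.
Variable R : realType.
Implicit Types (t u v : R).

(** The hypothesis says [g = o(p - p t)], and the difference quotients of [p] at [t] are bounded. *)
Lemma is_derive0_dominated (g p : R -> R) t :
  (forall e, 0 < e -> \forall s \near t, `|g s| <= e * `|p s - p t|) ->
  derivable p t 1 -> is_derive t 1 g 0.
Proof.
move=> gp dp.
have gt0 : g t = 0.
  apply/eqP; rewrite -normr_le0.
  by have := nbhs_singleton (gp _ ltr01); rewrite subrr normr0 mulr0.
suff H : h^-1 *: (g (h *: (1 : R) + t) - g t) @[h --> 0^'] --> (0 : R).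
  by apply: DeriveDef; [apply/cvg_ex; exists 0|exact: cvg_lim].
have [l pl] := (cvg_ex _).1 dp.
apply/cvgrPdist_lt => e e0; rewrite gt0.
have l1 : 0 < `|l| + 1 by rewrite ltr_wpDl.
have gs : \forall h \near 0^', `|g (h *: (1 : R) + t)| <=
    e / (`|l| + 1) * `|p (h *: (1 : R) + t) - p t|.
  have : (h *: (1 : R) + t) @[h --> 0^'] --> t.
    rewrite -[X in _ --> X]add0r; apply: cvgD; last exact: cvg_cst.
    rewrite -[X in _ --> X](scale0r (1 : R)); apply: cvgZl.
    by apply: cvg_within_filter; exact: cvg_id.
  by move=> /(_ _ (gp _ (divr_gt0 e0 l1))).
move/cvgrPdist_lt : pl => /(_ _ ltr01) /= pl.
near=> h.
have h0 : h != 0 by near: h; exact: nbhs_dnbhs_neq.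
rewrite sub0r normrN subr0 normrZ normfV.
have G : `|g (h *: (1 : R) + t)| <= e / (`|l| + 1) * `|p (h *: (1 : R) + t) - p t|.
  by near: h.
have P : `|l - h^-1 *: (p (h *: (1 : R) + t) - p t)| < 1 by near: h.
set dpt := p _ - p t in G P.
have Q : `|h|^-1 * `|dpt| < `|l| + 1.
  rewrite -normfV -normrM; rewrite distrC in P.
  rewrite -[X in `|X|](subrK l) addrC (le_lt_trans (ler_normD _ _)) //.
  by rewrite ltrD2l.
apply: le_lt_trans (ler_wpM2l _ G) _; first by rewrite invr_ge0.
rewrite mulrCA -[ltRHS](divfK (lt0r_neq0 l1)) ltr_pM2l ?divr_gt0 //.
Unshelve. all: by end_near. Qed.

(** The increment is taken in two stages. Moving [q] with the first variable frozen at [p t] is a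
    one-variable chain rule; then moving [p] is controlled by the mean value theorem and the
    continuity of [au]. *)
Lemma is_derive_chain2 (a au : R -> R -> R) (p q : R -> R) t (av dp dq e : R) :
  0 < e ->
  (forall u v, `|u - p t| < e -> `|v - q t| < e ->
     is_derive u 1 (a ^~ v) (au u v)) ->
  is_derive (q t) 1 (a (p t)) av ->
  {for (p t, q t), continuous (fun z : R * R => au z.1 z.2)} ->
  is_derive t 1 p dp -> is_derive t 1 q dq ->
  is_derive t 1 (fun s => a (p s) (q s)) (au (p t) (q t) * dp + av * dq).
Proof.
move=> e0 du dv cu Dp Dq.
(* The error made by linearizing the second stage; the mean value theorem bounds it by any small
   multiple of [p s - p t]. *)
pose g s := a (p s) (q s) - a (p t) (q s) - au (p t) (q t) * (p s - p t).
have cp : {for t, continuous p}.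
  by apply/differentiable_continuous/derivable1_diffP; case: Dp.
have cq : {for t, continuous q}.
  by apply/differentiable_continuous/derivable1_diffP; case: Dq.
have Dg : is_derive t 1 g 0.
  apply: (is_derive0_dominated (p := p)); last by case: Dp.
  move=> d d0; move/cvgrPdist_lt : cu => /(_ _ d0) /= cu.
  have [[P Q] [/= /nbhs_ballP[r /= r0 rP] /nbhs_ballP[r' /= r'0 rQ]] PQ] := cu.
  pose m := Num.min e (Num.min r r').
  have m0 : 0 < m by rewrite !lt_min e0 r0 r'0.
  have me : m <= e by rewrite ge_min lexx.
  have mr : m <= r by rewrite !ge_min lexx orbT.
  have mr' : m <= r' by rewrite !ge_min lexx !orbT.
  move/cvgrPdist_lt : cp => /(_ _ m0) cp; move/cvgrPdist_lt : cq => /(_ _ m0) cq.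
  near=> s.
  have ps : `|p t - p s| < m by near: s.
  have qs : `|q t - q s| < m by near: s.
  have qe : `|q s - q t| < e by rewrite distrC (lt_le_trans qs).
  have bnd c : `|c - p t| < m -> `|au c (q s) - au (p t) (q t)| <= d.
    move=> cm; rewrite distrC ltW //; apply: (PQ (c, q s)); split => /=.
      by apply: rP; rewrite /ball /= distrC (lt_le_trans cm).
    by apply: rQ; rewrite /ball /= (lt_le_trans qs).
  have mvt x y : x <= y -> (forall c, x <= c <= y -> `|c - p t| < m) ->
      `|a y (q s) - a x (q s) - au (p t) (q t) * (y - x)| <= d * `|y - x|.
    move=> xy cI.
    have dI c : x <= c <= y -> is_derive c 1 (a ^~ (q s)) (au c (q s)).
      by move=> /cI cm; apply: du => //; exact: lt_le_trans me.
    have dI' c : c \in `]x, y[ -> is_derive c 1 (a ^~ (q s)) (au c (q s)).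
      by rewrite in_itv /= => /andP[/ltW xc /ltW cy]; apply: dI; rewrite xc.
    have cI' : {within `[x, y], continuous (a ^~ (q s))}.
      by apply: derivable_within_continuous => c; rewrite in_itv /= => /dI; case.
    have [c cxy ->] := MVT_segment xy dI' cI'.
    rewrite -mulrBl normrM ler_wpM2r //; apply: bnd; apply: cI.
    by move: cxy; rewrite in_itv.
  rewrite /g; have [pts|pst] := leP (p t) (p s).
    apply: mvt => // c /andP[c1 c2]; rewrite ger0_norm ?subr_ge0 //.
    by move: ps; rewrite distrC ger0_norm ?subr_ge0 //; lra.
  have <- : `|a (p t) (q s) - a (p s) (q s) - au (p t) (q t) * (p t - p s)| =
      `|a (p s) (q s) - a (p t) (q s) - au (p t) (q t) * (p s - p t)|.
    by rewrite -normrN; congr (`|_|); ring.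
  rewrite [X in _ <= _ * X]distrC; apply: mvt; first exact: ltW.
  move=> c /andP[c1 c2]; rewrite distrC ger0_norm ?subr_ge0 //.
  by move: ps; rewrite ger0_norm ?subr_ge0 ?(ltW pst) //; lra.
have Da := is_derive_comp1 Dq dv.
have -> : (fun s => a (p s) (q s)) =
    (fun s => g s + (a (p t) (q s) + au (p t) (q t) * (p s - p t))).
  by apply/funext => s; rewrite /g; ring.
have Dp' := is_deriveMl (au (p t) (q t)) (is_deriveB Dp (is_derive_cst (p t) t 1)).
by apply: is_derive_eq; rewrite add0r subr0 addrC.
Unshelve. all: by end_near. Qed.

End PlanarCalculus.

(** * Parametric integrals and series of functions *)

Section ParametricIntegral.
Variable R : realType.
Implicit Types (a b r t x u v : R).

Lemma is_derive_segint (f df : R -> R -> R) (a b u v r M : R) :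
  u < r < v ->
  (forall x, u < x < v -> continuous (f x)) ->
  (forall x t, u < x < v -> a <= t <= b -> is_derive x 1 (f ^~ t) (df x t)) ->
  (forall x t, u < x < v -> a <= t <= b -> `|df x t| <= M) ->
  is_derive r 1 (fun x => segint a b (f x)) (segint a b (df r)).
Proof.
move=> rI cf Df dM.
have Ir : `]u, v[%classic r by rewrite /= in_itv.
(* A dominating constant has to be nonnegative, and [M] could be negative when [[a, b]] is empty. *)
have iG : lebesgue_measure.-integrable `[a, b] (EFin \o (fun=> `|M|) : R -> _).
  by apply: segint_integrable => ?; exact: cvg_cst.
have If x : `]u, v[%classic x -> lebesgue_measure.-integrable `[a, b] (EFin \o f x).
  by rewrite /= in_itv /= => /cf; exact: segint_integrable.
have Id x t : `]u, v[%classic x -> `[a, b]%classic t -> derivable (f ^~ t) x 1.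
  by rewrite /= !in_itv /= => xI tI; case: (Df _ _ xI tI).
have dE x t : `]u, v[%classic x -> `[a, b]%classic t -> partial1of2 f x t = df x t.
  by rewrite /= !in_itv /= partial1of2E => xI tI; case: (Df _ _ xI tI).
have Ig x t : `]u, v[%classic x -> `[a, b]%classic t -> `|partial1of2 f x t| <= `|M|.
  move=> xI tI; rewrite dE //; apply: le_trans (ler_norm M).
  by apply: dM; [move: xI; rewrite /= in_itv|move: tI; rewrite /= in_itv].
have mI : measurable (`[a, b]%classic : set (measurableTypeR R)) by [].
apply: DeriveDef.
  exact: (derivable_under_integral mI Ir If Id (fun=> normr_ge0 M) iG Ig).
rewrite -derive1E.
rewrite (differentiation_under_integral mI Ir If Id (fun=> normr_ge0 M) iG Ig).
by apply: eq_Rintegral => t; rewrite inE => tI; rewrite -dE.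
Qed.

Lemma derive0_eq (f : R -> R) a b x y :
  (forall z, a < z < b -> is_derive z 1 f 0) -> a < x < b -> a < y < b -> f x = f y.
Proof.
move=> df; wlog xy : x y / x <= y => [H xI yI|].
  by have [|/ltW] := leP x y => xy; [|symmetry]; exact: H.
move=> xI yI.
have dI c : x <= c <= y -> is_derive c 1 f 0 by move=> cI; apply: df; lra.
have dI' c : c \in `]x, y[ -> is_derive c 1 f 0.
  by rewrite in_itv /= => /andP[/ltW xc /ltW cy]; apply: dI; rewrite xc.
have cI : {within `[x, y], continuous f}.
  by apply: derivable_within_continuous => c; rewrite in_itv /= => /dI; case.
have [c _] := MVT_segment xy dI' cI.
by rewrite mul0r => /eqP; rewrite subr_eq0 => /eqP.
Qed.

Lemma is_derive_exprn k x :
  is_derive x 1 (fun y : R => y ^+ k.+1) (k.+1%:R * x ^+ k).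
Proof.
have -> : (fun y : R => y ^+ k.+1) = (id : R -> R) ^+ k.+1.
  by apply/funext => y; rewrite exprfctE.
by apply: is_derive_eq; rewrite /GRing.scale /= mulr1.
Qed.

(** By Euler's equation [f x / x ^+ k] has zero derivative; the conclusion is cross-multiplied to
    stay free of quotients. *)
Lemma euler_homogeneous (f df : R -> R) k rho r s :
  (forall x, 0 < x < rho -> is_derive x 1 f (df x) /\ x * df x = k%:R * f x) ->
  0 < r < rho -> 0 < s < rho -> f r * s ^+ k = f s * r ^+ k.
Proof.
move=> fE rI sI.
suff : f r / r ^+ k = f s / s ^+ k.
  have r0 : r ^+ k != 0 by rewrite expf_eq0 gt_eqF ?andbF //; case/andP: rI.
  have s0 : s ^+ k != 0 by rewrite expf_eq0 gt_eqF ?andbF //; case/andP: sI.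
  by move/eqP; rewrite eqr_div // => /eqP.
apply: (derive0_eq (f := fun x => f x / x ^+ k) _ rI sI) => x xI.
have [dfx E] := fE x xI.
have x0 : x != 0 by rewrite gt_eqF //; case/andP: xI.
case: k {fE} E => [|k] E.
  have -> : (fun x => f x / x ^+ 0) = f by apply/funext => y; rewrite divr1.
  apply: is_derive_eq; apply: (mulfI x0); rewrite E; ring.
have xk : x ^+ k.+1 != 0 by rewrite expf_neq0.
have Dx := is_derive_exprn k x.
have DV := is_deriveV (f := fun y : R => y ^+ k.+1) xk Dx.
apply: is_derive_eq; rewrite /GRing.scale /=.
apply: (mulfI x0); rewrite mulr0 mulrDr.
have -> : x * ((x ^+ k.+1)^-1 * df x) = (x ^+ k.+1)^-1 * (k.+1%:R * f x).
  by rewrite mulrCA E.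
move: xk; rewrite exprS mulf_eq0 negb_or => /andP[_]; move: (x ^+ k) => y y0.
by field; rewrite y0.
Qed.

End ParametricIntegral.

(** * Series dominated by a geometric series *)

Section GeometricDomination.
Variable R : realType.
Implicit Types (C q : R).

(** The finite differences are bounded by a partial geometric sum, and the bound passes to the
    limit. Its explicit form makes it uniform in any parameter on which [u] depends. *)
Lemma geometric_tail (u : nat -> R) C q : 0 <= q < 1 ->
  (forall k, `|u k| <= C * q ^+ k) ->
  cvgn (series u) /\
  forall N, `|limn (series u) - series u N| <= C * q ^+ N / (1 - q).
Proof.
move=> /andP[q0 q1] uC.
have C0 : 0 <= C by have := uC 0%N; rewrite expr0 mulr1; exact: le_trans.
have cu : cvgn (series u).
  apply: normed_cvg; apply: (@series_le_cvg _ _ (geometric C q)) => //.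
  - by move=> k; exact: normr_ge0.
  - by move=> k; exact: geometric_ge0.
  - by apply: is_cvg_geometric_series; rewrite ger0_norm.
split=> // N.
have q1' : 0 < 1 - q by rewrite subr_gt0.
have part d : `|series u (d + N)%N - series u N| <= C * (q ^+ N - q ^+ (d + N)) / (1 - q).
  elim: d => [|d IH]; first by rewrite add0n !subrr normr0 mulr0 mul0r.
  rewrite addSn seriesSr addrAC (le_trans (ler_normD _ _)) //.
  apply: le_trans (lerD IH (uC _)) _.
  rewrite le_eqVlt; apply/predU1P; left; rewrite exprS; field.
  by rewrite gt_eqF.
have lim_sub : (fun d => `|series u (d + N)%N - series u N|) @ \oo -->
    `|limn (series u) - series u N|.
  apply: cvg_norm; apply: cvgB; last exact: cvg_cst.
  by rewrite (cvg_shiftn N).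
apply: (closed_cvg (fun x => x <= C * q ^+ N / (1 - q)) _ _ _ lim_sub).
  exact: closed_le.
apply: nearW => d; apply: le_trans (part d) _.
rewrite ler_pM2r ?invr_gt0 // ler_wpM2l // lerBlDr lerDl exprn_ge0 //.
Qed.

Lemma geometric_small C q e : 0 <= q < 1 -> 0 < e ->
  exists N0, forall N, (N0 <= N)%N -> `|C * q ^+ N / (1 - q)| < e.
Proof.
move=> /andP[q0 q1] e0.
have q1' : 0 < 1 - q by rewrite subr_gt0.
have : geometric (C / (1 - q)) q @ \oo --> 0.
  by apply: cvg_geometric; rewrite ger0_norm.
move=> /cvgrPdist_lt /(_ _ e0) [N0 _ H]; exists N0 => N /H /=.
by rewrite sub0r normrN mulrAC.
Qed.

Lemma continuous_uniform_approx (S : R -> R) :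
  (forall e, 0 < e -> exists2 g : R -> R, continuous g & forall t, `|S t - g t| <= e) ->
  continuous S.
Proof.
move=> H t; apply/cvgrPdist_lt => e e0.
have e3 : 0 < e / 3 by rewrite divr_gt0.
have [g cg Sg] := H _ e3.
have /cvgrPdist_lt /(_ _ e3) cgt := cg t.
near=> s.
have gts : `|g t - g s| < e / 3 by near: s.
have := Sg t; have := Sg s; rewrite [`|S s - _|]distrC => Ss St.
have -> : S t - S s = (S t - g t) + (g t - g s) + (g s - S s) by ring.
have := ler_normD (S t - g t + (g t - g s)) (g s - S s).
have := ler_normD (S t - g t) (g t - g s).
by lra.
Unshelve. all: by end_near. Qed.

Section FunctionSeries.
Variables (u : nat -> R -> R) (C q : R).
Hypothesis cu : forall k, continuous (u k).
Hypothesis q01 : 0 <= q < 1.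
Hypothesis uC : forall k t, `|u k t| <= C * q ^+ k.

Definition fseries (t : R) : R := limn (series (fun k => u k t)).

Lemma fseries_cvg t : series (fun k => u k t) @ \oo --> fseries t.
Proof. by have [] := geometric_tail q01 (uC ^~ t). Qed.

Lemma fseries_tail N t :
  `|fseries t - \sum_(k < N) u k t| <= C * q ^+ N / (1 - q).
Proof.
have [_ /(_ N)] := geometric_tail q01 (uC ^~ t).
by rewrite /series /= big_mkord.
Qed.

Lemma continuous_fpartial N : continuous (fun t => \sum_(k < N) u k t).
Proof.
elim: N => [|N IH].
  have -> : (fun t : R => \sum_(k < 0) u k t) = cst 0.
    by apply/funext => t; rewrite big_ord0.
  by move=> ?; exact: cvg_cst.
have -> : (fun t : R => \sum_(k < N.+1) u k t) = (fun t => \sum_(k < N) u k t + u N t).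
  by apply/funext => t; rewrite big_ord_recr.
exact: continuousDr IH (@cu N).
Qed.

Lemma continuous_fseries : continuous fseries.
Proof.
apply: continuous_uniform_approx => e e0.
have [N /(_ N (leqnn N)) CN] := geometric_small C q01 e0.
exists (fun t => \sum_(k < N) u k t); first exact: continuous_fpartial.
move=> t; apply: le_trans (fseries_tail N t) _.
exact: le_trans (ler_norm _) (ltW CN).
Qed.

(** Uniform convergence allows termwise integration. The partial integrals are taken to be
    eventually constant because, for an orthogonal system, only one term contributes. *)
Lemma segint_fseries a b (phi : R -> R) (A : R) N0 : a <= b -> continuous phi ->
  (forall N, (N0 <= N)%N -> segint a b (fun t => (\sum_(k < N) u k t) * phi t) = A) ->
  segint a b (fun t => fseries t * phi t) = A.
Proof.
move=> ab cphi HA; apply/eqP; rewrite -subr_eq0 -normr_le0 leNgt; apply/negP => d0.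
set d := `|_| in d0.
have cn : continuous (fun t => `|phi t|) by move=> t; apply: cvg_norm; exact: cphi.
pose I := segint a b (fun t => `|phi t|).
have I0 : 0 <= I by apply: segint_ge0.
have I1 : 0 < I + 1 by rewrite ltr_wpDl.
have [N1 HN1] := geometric_small C q01 (divr_gt0 d0 I1).
pose N := maxn N0 N1.
have := HN1 N (leq_maxr _ _); set tl := C * _ / _ => tld.
have : d <= `|tl| * I.
  rewrite /d -(HA N (leq_maxl _ _)).
  have cS := continuousMr continuous_fseries cphi.
  have cP := continuousMr (@continuous_fpartial N) cphi.
  rewrite -[X in X - _]mul1r -[X in _ + X]mulN1r -segint_lin //.
  rewrite /I -segintZ //; apply: norm_segint_le => //.
  - by apply: continuousDr; exact: continuousMl.
  - exact: continuousMl.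
  - move=> t _; rewrite mul1r mulN1r -mulrBl normrM ler_wpM2r //.
    exact: le_trans (fseries_tail N t) (ler_norm _).
have : `|tl| * I <= `|tl| * (I + 1) by rewrite ler_wpM2l // lerDl.
by move: tld; rewrite ltr_pdivlMr // => *; lra.
Qed.

End FunctionSeries.

End GeometricDomination.

(** * Orthogonality *)

Section AppellOrthogonality.
Variable R : realType.
Implicit Types (m k j : nat) (t : R).

Lemma is_derive_sinX m t :
  is_derive t 1 (fun x : R => sin x ^+ m) (m%:R * sin t ^+ m.-1 * cos t).
Proof.
case: m => [|m]; last first.
  exact: is_derive_comp1 (is_derive_sin t) (is_derive_exprn m (sin t)).
by rewrite !mul0r; have := is_derive_cst (1 : R) t 1; congr is_derive;
  apply/funext => x; rewrite expr0.
Qed.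

Lemma continuous_sinX m : continuous (fun x : R => sin x ^+ m).
Proof. by apply: is_derive_continuous => t; exact: is_derive_sinX. Qed.

Lemma continuous_appell_cos m k : continuous (@appell_cos R m k).
Proof. by apply: is_derive_continuous => t; exact: is_derive_appell_cos. Qed.

Lemma continuous_appell_sin m k : continuous (@appell_sin R m k).
Proof. by apply: is_derive_continuous => t; exact: is_derive_appell_sin. Qed.

Definition cos_pairing m j k : R :=
  segint 0 pi (fun t => appell_cos m j t * (appell_cos m k t * sin t ^+ m)).
Definition sin_pairing m j k : R :=
  segint 0 pi (fun t => appell_sin m j t * (appell_sin m k t * sin t ^+ m)).

(** Integration by parts with [a_j' = -(j + m) b_j] and [(sin^m b_k)' = k sin^m a_k]; the boundary
    terms vanish because [b_k] does at [0] and [pi]. *)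
Lemma pairing_parts m j k :
  k%:R * cos_pairing m j k = (j + m)%:R * sin_pairing m j k.
Proof.
have ca := continuous_appell_cos; have cb := continuous_appell_sin.
have cw := @continuous_sinX m.
have cg : continuous (fun t : R => k%:R * (sin t ^+ m * appell_cos m k t)).
  by apply: continuousMl; exact: continuousMr cw (ca m k).
have cf : continuous (fun t : R => - ((j + m)%:R * appell_sin m j t)).
  move=> t; apply: cvgN; apply: cvgMr; exact: cb.
have := segint_by_parts (pi_gt0 R) cf cg (is_derive_appell_cos m j)
  (is_derive_weighted_appell_sin m k).
rewrite appell_sinpi appell_sin0 !mulr0 subrr sub0r => E.
rewrite /cos_pairing -segintZ; last first.
  by apply: continuousMr; [exact: ca|exact: continuousMr (ca m k) cw].
rewrite /sin_pairing -[RHS]opprK -mulNr -segintZ; last first.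
  by apply: continuousMr; [exact: cb|exact: continuousMr (cb m k) cw].
transitivity (segint 0 pi (fun t : R =>
    appell_cos m j t * (k%:R * (sin t ^+ m * appell_cos m k t)))).
  by apply: eq_segint => t _; ring.
by rewrite E; congr (- _); apply: eq_segint => t _; ring.
Qed.

Lemma cos_pairingC m j k : cos_pairing m j k = cos_pairing m k j.
Proof. by apply: eq_segint => t _; ring. Qed.

Lemma sin_pairingC m j k : sin_pairing m j k = sin_pairing m k j.
Proof. by apply: eq_segint => t _; ring. Qed.

(** Exchanging [j] and [k] in [pairing_parts] gives two linear equations for the pairings, of
    determinant [(k - j) (k + j + m)] up to sign. *)
Lemma pairing_orth m j k : j != k ->
  cos_pairing m j k = 0 /\ sin_pairing m j k = 0.
Proof.
move=> jk; have E1 := pairing_parts m j k; have := pairing_parts m k j.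
rewrite cos_pairingC sin_pairingC => E2.
move: E1 E2; set X := cos_pairing m j k; set Y := sin_pairing m j k.
rewrite !natrD => E1 E2.
have kj : (k%:R - j%:R : R) != 0 by rewrite subr_eq0 eqr_nat eq_sym.
have XY : X + Y = 0.
  apply: (mulfI kj); rewrite mulr0.
  have -> : (k%:R - j%:R) * (X + Y) = (k%:R * X - (j%:R + m%:R) * Y) -
     (j%:R * X - (k%:R + m%:R) * Y) by ring.
  by rewrite E1 E2; ring.
have YX : Y = - X by apply/eqP; rewrite -addr_eq0 addrC XY.
have kjm : (k%:R + j%:R + m%:R : R) != 0.
  by rewrite -!natrD pnatr_eq0; move/eqP: jk => jk; apply/eqP; lia.
suff X0 : X = 0 by rewrite YX X0 oppr0.
apply: (mulfI kjm); rewrite mulr0; move: E1; rewrite YX => E1.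
have -> : (k%:R + j%:R + m%:R) * X = k%:R * X - (j%:R + m%:R) * - X by ring.
by rewrite E1 subrr.
Qed.

(** The integrand is nonnegative, so a short segment [[0, d]] suffices. There [a_k >= 1/2], since
    [|a_k'| <= k + m]; inserting a factor [cos t <= 1] makes the integral explicit,
    [sin^(m+1) d / (m + 1)], and [sin d >= d cos 1]. *)
Lemma cos_pairing_lower m : exists kappa lambda : R,
  [/\ 0 < kappa, 0 < lambda & forall k, kappa * lambda ^+ k <= cos_pairing m k k].
Proof.
have c1 := cos1_gt0 R.
pose w : R := cos 1 * (2^-1) ^+ m.+1.
have w0 : 0 < w by rewrite mulr_gt0 // exprn_gt0.
exists (4^-1 * (w ^+ m.+1 / m.+1%:R)), ((2^-1) ^+ m.+1); split=> [||k].
- by rewrite !mulr_gt0 ?exprn_gt0 ?invr_gt0 ?ltr0n.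
- by rewrite exprn_gt0 ?invr_gt0.
(* Since [k + m < 2^(k + m)], this gives [(k + m) d <= 1/2], and powers of [d] are already geometric
   in [k]. *)
pose d : R := (2^-1) ^+ (k + m.+1).
have d0 : 0 < d by rewrite exprn_gt0 ?invr_gt0.
have d1 : d <= 1 by apply: exprn_ile1; lra.
have dpi : d <= pi by apply: le_trans d1 _; have := pi_ge2 R; lra.
have dk : (k + m)%:R * d <= 2^-1.
  rewrite /d addnS exprS mulrCA -[leRHS]mulr1 ler_wpM2l ?invr_ge0 //.
  rewrite exprVn ler_pdivrMr ?exprn_gt0 // mul1r -natrX ler_nat ltnW //.
  exact: ltn_expl.
have a_ge t : 0 <= t <= d -> 2^-1 <= appell_cos m k t.
  move=> /andP[t0 td].
  have dI x : x \in `]0, t[ -> is_derive x 1 (appell_cos m k)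
      (- ((k + m)%:R * appell_sin m k x)).
    by move=> _; exact: is_derive_appell_cos.
  have cI : {within `[0, t], continuous (appell_cos m k)}.
    by apply: continuous_subspaceT; exact: continuous_appell_cos.
  have [x _] := MVT_segment t0 dI cI; rewrite appell_cos0 subr0 => E.
  have : `|appell_cos m k t - 1| <= (k + m)%:R * d.
    rewrite E normrM normrN normrM normr_nat (ger0_norm t0).
    by apply: ler_pM => //; rewrite ler_piMr // norm_appell_sin_le1.
  by rewrite ler_norml => /andP[]; lra.
have sind : cos 1 * d <= sin d.
  have dI x : x \in `]0, d[ -> is_derive x 1 (@sin R) (cos x).
    by move=> _; exact: is_derive_sin.
  have cI : {within `[0, d], continuous (@sin R)}.
    by apply: continuous_subspaceT; exact: continuous_sin.
  have [x + ] := MVT_segment (ltW d0) dI cI; rewrite sin0 !subr0 => xI ->.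
  rewrite ler_pM2r // leNgt ltr_cos.
  - rewrite -leNgt; move: xI; rewrite in_itv /= => /andP[_ xd].
    exact: le_trans xd d1.
  - by rewrite in_itv /=; have := pi_ge2 R; lra.
  - move: xI; rewrite !in_itv /= => /andP[-> xd] /=.
    exact: le_trans xd dpi.
have cw := @continuous_sinX m.
have caa : continuous (fun t : R =>
    appell_cos m k t * (appell_cos m k t * sin t ^+ m)).
  apply: continuousMr; first exact: continuous_appell_cos.
  by apply: continuousMr => //; exact: continuous_appell_cos.
have csc : continuous (fun t : R => sin t ^+ m * cos t).
  by apply: continuousMr => //; exact: continuous_cos.
have sge t : 0 <= t <= pi -> 0 <= sin t ^+ m.
  by move=> tI; rewrite exprn_ge0 // sin_ge0_pi.
rewrite /cos_pairing (segint_split caa (ltW d0) dpi).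
have E0 : segint 0 d (fun t => sin t ^+ m * cos t) = m.+1%:R^-1 * sin d ^+ m.+1.
  have -> : m.+1%:R^-1 * sin d ^+ m.+1 =
      m.+1%:R^-1 * sin d ^+ m.+1 - m.+1%:R^-1 * sin 0 ^+ m.+1.
    by rewrite sin0 expr0n /= mulr0 subr0.
  apply: (@segint_FTC _ 0 d _ (fun t : R => m.+1%:R^-1 * sin t ^+ m.+1)) => // t.
  have := is_deriveMl m.+1%:R^-1 (is_derive_sinX m.+1 t).
  by congr is_derive => /=; field; rewrite addrC natr1 pnatr_eq0.
apply: (@le_trans _ _ (segint 0 d (fun t => 4^-1 * (sin t ^+ m * cos t)))).
  rewrite segintZ // E0 -mulrA ler_pM2l ?invr_gt0 //.
  rewrite mulrAC [leRHS]mulrC ler_pM2r ?invr_gt0 ?ltr0n //.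
  rewrite -exprM mulnC exprM -exprMn.
  apply: lerXn2r; rewrite ?nnegrE ?sin_ge0_pi ?(ltW d0) //.
    by rewrite mulr_ge0 ?(ltW w0) // exprn_ge0 ?invr_ge0.
  apply: le_trans sind; rewrite le_eqVlt; apply/predU1P; left.
  by rewrite /w /d exprD mulrA mulrAC.
rewrite -[leLHS]addr0; apply: lerD; last first.
  apply: segint_ge0 => t /andP[dt tpi]; rewrite mulrA mulr_ge0 //.
    by rewrite -expr2 sqr_ge0.
  by apply: sge; rewrite tpi (le_trans (ltW d0)).
apply: le_segint => [|//|t tI]; first exact: continuousMl.
have s0 : 0 <= sin t ^+ m by apply: sge; lra.
rewrite mulrCA mulrC [leRHS]mulrA; apply: ler_wpM2r => //.
apply: (@le_trans _ _ (2^-1 * 2^-1)); last first.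
  by apply: ler_pM; rewrite ?invr_ge0 ?a_ge.
by have := cos_le1 t; lra.
Qed.

End AppellOrthogonality.

(** * The Vekua system in polar coordinates *)

Section PolarCoordinates.
Variable R : realType.
Implicit Types (r t u v : R) (a g : R -> R -> R).

Definition polar g r t : R := g (r * cos t) (r * sin t).

(** The square contains all points of polar radius [|r| < rho] and both signs of each coordinate, so
    that derivatives on the real axis and at the origin are two-sided. *)
Definition planar_C1 (rho : R) a au av : Prop := forall u v, `|u| < rho -> `|v| < rho ->
  [/\ is_derive u 1 (a ^~ v) (au u v), is_derive v 1 (a u) (av u v),
      {for (u, v), continuous (fun z : R * R => au z.1 z.2)} &
      {for (u, v), continuous (fun z : R * R => av z.1 z.2)}].

Lemma norm_cosM_lt r t rho : `|r| < rho -> `|r * cos t| < rho.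
Proof. by apply: le_lt_trans; rewrite normrM ler_piMr ?cos_max. Qed.

Lemma norm_sinM_lt r t rho : `|r| < rho -> `|r * sin t| < rho.
Proof. by apply: le_lt_trans; rewrite normrM ler_piMr ?sin_max. Qed.

Section Derivatives.
Variables (rho : R) (a au av : R -> R -> R).
Hypothesis aC1 : planar_C1 rho a au av.

Lemma planar_chain (p q : R -> R) (t dp dq : R) :
  `|p t| < rho -> `|q t| < rho -> is_derive t 1 p dp -> is_derive t 1 q dq ->
  is_derive t 1 (fun s => a (p s) (q s)) (au (p t) (q t) * dp + av (p t) (q t) * dq).
Proof.
move=> prho qrho Dp Dq.
have [_ dv cu _] := aC1 prho qrho.
pose e := Num.min (rho - `|p t|) (rho - `|q t|).
have e0 : 0 < e by rewrite lt_min !subr_gt0 prho qrho.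
have e1 : e <= rho - `|p t| by rewrite ge_min lexx.
have e2 : e <= rho - `|q t| by rewrite ge_min lexx orbT.
apply: (is_derive_chain2 e0 _ dv cu Dp Dq) => u v ue ve.
have urho : `|u| < rho.
  by have := ler_normD (u - p t) (p t); rewrite subrK; lra.
have vrho : `|v| < rho.
  by have := ler_normD (v - q t) (q t); rewrite subrK; lra.
by have [] := aC1 urho vrho.
Qed.

Lemma is_derive_polar_angle r t : `|r| < rho ->
  is_derive t 1 (polar a r)
    (polar au r t * (r * - sin t) + polar av r t * (r * cos t)).
Proof.
move=> rrho; apply: (planar_chain (p := fun s => r * cos s) (q := fun s => r * sin s)).
- exact: norm_cosM_lt.
- exact: norm_sinM_lt.
Qed.

Lemma is_derive_polar_radius r t : `|r| < rho ->
  is_derive r 1 (polar a ^~ t) (polar au r t * cos t + polar av r t * sin t).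
Proof.
move=> rrho.
have Dl (c : R) : is_derive r 1 (fun s => s * c) c.
  have := is_derive_scaled c r; congr is_derive.
  by apply/funext => s; rewrite mulrC.
apply: (planar_chain (p := fun s => s * cos t) (q := fun s => s * sin t)).
- exact: norm_cosM_lt.
- exact: norm_sinM_lt.
Qed.

Lemma continuous_polar_of g r : `|r| < rho ->
  (forall u v, `|u| < rho -> `|v| < rho ->
     {for (u, v), continuous (fun z : R * R => g z.1 z.2)}) ->
  continuous (polar g r).
Proof.
move=> rrho cg t.
have cc : {for t, continuous (fun s : R => (r * cos s, r * sin s))}.
  have cm : continuous (fun s : R => r * cos s) := continuousMl (@continuous_cos R).
  have cn : continuous (fun s : R => r * sin s) := continuousMl (@continuous_sin R).
  exact: cvg_pair (cm t) (cn t).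
exact: (continuous_comp cc (cg _ _ (norm_cosM_lt t rrho) (norm_sinM_lt t rrho))).
Qed.

Lemma continuous_polar r : `|r| < rho -> continuous (polar a r).
Proof.
by move=> rrho; apply: is_derive_continuous => t; exact: is_derive_polar_angle.
Qed.

Lemma continuous_polar_partials r : `|r| < rho ->
  continuous (polar au r) /\ continuous (polar av r).
Proof.
by move=> rrho; split; apply: continuous_polar_of => // u v /aC1 /[apply] -[].
Qed.

End Derivatives.

Lemma local_bound g : {for (0, 0), continuous (fun z : R * R => g z.1 z.2)} ->
  exists e M : R, 0 < e /\ forall u v, `|u| < e -> `|v| < e -> `|g u v| <= M.
Proof.
move=> /cvgrPdist_lt /(_ _ ltr01) /= cg.
have [[P Q] [/= /nbhs_ballP[e1 /= e10 rP] /nbhs_ballP[e2 /= e20 rQ]] PQ] := cg.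
exists (Num.min e1 e2), (`|g 0 0| + 1); split; first by rewrite lt_min e10 e20.
move=> u v; rewrite !lt_min => /andP[u1 _] /andP[_ v2].
have /= : (fun t : R * R => `|g 0 0 - g t.1 t.2| < 1) (u, v).
  apply: PQ; split => /=.
    by apply: rP; rewrite /ball /= sub0r normrN.
  by apply: rQ; rewrite /ball /= sub0r normrN.
rewrite distrC => H; have := ler_normD (g u v - g 0 0) (g 0 0).
by rewrite subrK; lra.
Qed.

(** Continuity of the partial derivatives at the origin gives, on a smaller square, the bound used
    to differentiate moments under the integral sign. *)
Lemma planar_C1_bound rho a au av : 0 < rho -> planar_C1 rho a au av ->
  exists e M : R, 0 < e /\ forall u v, `|u| < e -> `|v| < e ->
    `|au u v| <= M /\ `|av u v| <= M.
Proof.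
move=> rho0 aC1; have n0 : `|0 : R| < rho by rewrite normr0.
have [_ _ /local_bound[e1 [M1 [e10 H1]]] /local_bound[e2 [M2 [e20 H2]]]] :=
  aC1 _ _ n0 n0.
exists (Num.min e1 e2), (Num.max M1 M2); split; first by rewrite lt_min e10 e20.
move=> u v; rewrite !lt_min => /andP[u1 u2] /andP[v1 v2].
by rewrite !le_max H1 // H2 // orbT.
Qed.

End PolarCoordinates.

Section Vekua.
Variable R : realType.

(* The scalar system satisfied by the coordinates of the two components of an
   axially monogenic function on R^(m.+2); the right-hand side of vekua_div has
   the junk value 0 at v = 0, which is correct for m = 0 only. *)
Record vekua (m : nat) (rho : R) (a au av b bu bv : R -> R -> R) : Prop := Vekua {
  vekua_a : planar_C1 rho a au av;
  vekua_b : planar_C1 rho b bu bv;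
  vekua_curl : forall u v, `|u| < rho -> `|v| < rho -> av u v + bu u v = 0;
  vekua_div : forall u v, `|u| < rho -> `|v| < rho -> (v != 0) || (m == 0%N) ->
    au u v - bv u v = m%:R / v * b u v;
  vekua_b0 : forall u, `|u| < rho -> b u 0 = 0 }.

Definition cos_moment m k (a : R -> R -> R) (r : R) : R :=
  segint 0 pi (fun t => polar a r t * (appell_cos m k t * sin t ^+ m)).
Definition sin_moment m k (b : R -> R -> R) (r : R) : R :=
  segint 0 pi (fun t => polar b r t * (appell_sin m k t * sin t ^+ m)).

Section Moments.
Variables (m : nat) (rho M : R) (a au av b bu bv : R -> R -> R).
Hypothesis vk : vekua m rho a au av b bu bv.
Hypothesis aM : forall u v, `|u| < rho -> `|v| < rho -> `|au u v| <= M /\ `|av u v| <= M.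
Hypothesis bM : forall u v, `|u| < rho -> `|v| < rho -> `|bu u v| <= M /\ `|bv u v| <= M.

Lemma polar_b_pole r t : `|r| < rho -> sin t = 0 -> polar b r t = 0.
Proof.
move=> rrho st; rewrite /polar st mulr0.
exact: (vekua_b0 vk (norm_cosM_lt t rrho)).
Qed.

(** With [v = r sin t], multiplying by [r sin^m] clears [m / v], so the identity extends to the
    poles and to [r = 0], where [b] vanishes. At [m = 0] the truncated exponent [m.-1] sits behind
    the factor [m = 0]. *)
Lemma polar_div r t : `|r| < rho ->
  sin t ^+ m * (r * (polar au r t - polar bv r t)) =
  m%:R * sin t ^+ m.-1 * polar b r t.
Proof.
move=> rrho; have ur := norm_cosM_lt t rrho; have vr := norm_sinM_lt t rrho.
have [st|st] := eqVneq (sin t) 0.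
  rewrite (polar_b_pole rrho st) mulr0.
  have [m0|m0] := eqVneq m 0%N.
    have := vekua_div vk ur vr; rewrite m0 eqxx orbT => /(_ isT).
    by rewrite !mul0r /polar => ->; rewrite mulr0 mulr0.
  by rewrite st expr0n (negbTE m0) mul0r.
have [r0|r0] := eqVneq r 0.
  have -> : polar b r t = 0.
    by rewrite /polar r0 !mul0r (vekua_b0 vk) // -r0.
  by rewrite r0 mul0r !mulr0.
have := vekua_div vk ur vr; rewrite mulf_neq0 // => /(_ isT); rewrite -!/(polar _ r t) => ->.
case: m => [|m'] /=; first by rewrite !mul0r !mulr0.
by rewrite exprS; field; rewrite r0 st.
Qed.

Lemma polar_curl r t : `|r| < rho -> polar av r t = - polar bu r t.
Proof.
move=> rrho; have := vekua_curl vk (norm_cosM_lt t rrho) (norm_sinM_lt t rrho).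
by move/eqP; rewrite addr_eq0 => /eqP.
Qed.

Definition dcos_moment k r := segint 0 pi (fun t =>
  (polar au r t * cos t + polar av r t * sin t) * (appell_cos m k t * sin t ^+ m)).
Definition dsin_moment k r := segint 0 pi (fun t =>
  (polar bu r t * cos t + polar bv r t * sin t) * (appell_sin m k t * sin t ^+ m)).

Lemma is_derive_moment (g gu gv : R -> R -> R) (w : R -> R) (r : R) :
  planar_C1 rho g gu gv ->
  (forall u v, `|u| < rho -> `|v| < rho -> `|gu u v| <= M /\ `|gv u v| <= M) ->
  continuous w -> (forall t, `|w t| <= 1) -> `|r| < rho ->
  is_derive r 1 (fun r => segint 0 pi (fun t => polar g r t * w t))
    (segint 0 pi (fun t => (polar gu r t * cos t + polar gv r t * sin t) * w t)).
Proof.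
move=> gC1 gM cw w1 rrho.
have xr x : - rho < x < rho -> `|x| < rho by rewrite ltr_norml.
apply: (@is_derive_segint _ (fun x t => polar g x t * w t)
  (fun x t => (polar gu x t * cos t + polar gv x t * sin t) * w t)
  _ _ (- rho) rho r (M + M)).
- by rewrite -ltr_norml.
- by move=> x /xr xrho; exact: continuousMr (continuous_polar gC1 xrho) cw.
- move=> x t /xr xrho _; have Dg := is_derive_polar_radius gC1 t xrho.
  have := is_deriveMl (w t) Dg; rewrite mulrC; congr is_derive.
  by apply/funext => y; rewrite mulrC.
- move=> x t /xr xrho _.
  have [Mu Mv] := gM _ _ (norm_cosM_lt t xrho) (norm_sinM_lt t xrho).
  rewrite normrM -[leRHS]mulr1; apply: ler_pM => //.
  apply: le_trans (ler_normD _ _) _; rewrite !normrM.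
  have M0 : 0 <= M by exact: le_trans Mu.
  apply: lerD; rewrite -[leRHS]mulr1; apply: ler_pM => //; [exact: cos_max|exact: sin_max].
Qed.

Lemma weight_cos_le1 k (t : R) : `|appell_cos m k t * sin t ^+ m| <= 1.
Proof.
rewrite normrM -[leRHS]mulr1; apply: ler_pM => //; first exact: norm_appell_cos_le1.
by rewrite normrX exprn_ile1 // sin_max.
Qed.

Lemma weight_sin_le1 k (t : R) : `|appell_sin m k t * sin t ^+ m| <= 1.
Proof.
rewrite normrM -[leRHS]mulr1; apply: ler_pM => //; first exact: norm_appell_sin_le1.
by rewrite normrX exprn_ile1 // sin_max.
Qed.

Lemma continuous_weight_cos k : continuous (fun t : R => appell_cos m k t * sin t ^+ m).
Proof. exact: continuousMr (@continuous_appell_cos R m k) (@continuous_sinX R m). Qed.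

Lemma continuous_weight_sin k : continuous (fun t : R => appell_sin m k t * sin t ^+ m).
Proof. exact: continuousMr (@continuous_appell_sin R m k) (@continuous_sinX R m). Qed.

Lemma is_derive_cos_moment k (r : R) : `|r| < rho ->
  is_derive r 1 (cos_moment m k a) (dcos_moment k r).
Proof.
apply: is_derive_moment => //; first exact: vekua_a vk.
  exact: continuous_weight_cos.
exact: weight_cos_le1.
Qed.

Lemma is_derive_sin_moment k (r : R) : `|r| < rho ->
  is_derive r 1 (sin_moment m k b) (dsin_moment k r).
Proof.
apply: is_derive_moment => //; first exact: vekua_b vk.
  exact: continuous_weight_sin.
exact: weight_sin_le1.
Qed.

(** [r sin^m a_r] is the angular derivative of [sin^m b], and integration by parts differentiates
    [a_k] instead. The boundary terms vanish because [b] is zero on the real axis, which matters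
    when [m = 0]. *)
Lemma dcos_momentE k r : `|r| < rho ->
  r * dcos_moment k r = (k + m)%:R * sin_moment m k b r.
Proof.
move=> rrho.
have [cau cav] := continuous_polar_partials (vekua_a vk) rrho.
have [cbu cbv] := continuous_polar_partials (vekua_b vk) rrho.
have cb := continuous_polar (vekua_b vk) rrho.
have ca : continuous (polar a r) := continuous_polar (vekua_a vk) rrho.
have cc := @continuous_cos R; have cs := @continuous_sin R.
have csm := @continuous_sinX R m; have csm1 := @continuous_sinX R m.-1.
pose g t := m%:R * sin t ^+ m.-1 * cos t * polar b r t +
  sin t ^+ m * (polar bu r t * (r * - sin t) + polar bv r t * (r * cos t)).
have cg : continuous g.
  have cNs : continuous (fun t : R => - sin t) by move=> t; apply: cvgN; exact: cs.
  apply: continuousDr; apply: continuousMr => //.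
    by apply: continuousMr => //; exact: continuousMl.
  by apply: continuousDr; apply: continuousMr => //; exact: continuousMl.
have Dg (t : R) : is_derive t 1 (fun t => sin t ^+ m * polar b r t) (g t).
  have D1 := is_derive_sinX m t; have D2 := is_derive_polar_angle (vekua_b vk) t rrho.
  by apply: is_derive_eq; rewrite /GRing.scale /= addrC /g; congr (_ + _); rewrite mulrC.
have cf : continuous (fun t : R => - ((k + m)%:R * appell_sin m k t)).
  move=> t; apply: cvgN; apply: cvgMr; exact: continuous_appell_sin.
have := segint_by_parts (pi_gt0 R) cf cg (is_derive_appell_cos m k) Dg.
rewrite !polar_b_pole ?sin0 ?sinpi // !mulr0 subrr sub0r => E.
rewrite /dcos_moment -segintZ; last first.
  apply: continuousMr; last exact: continuous_weight_cos.
  by apply: continuousDr; exact: continuousMr.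
rewrite /sin_moment -[RHS]opprK -mulNr -segintZ; last first.
  by apply: continuousMr => //; exact: continuous_weight_sin.
transitivity (segint 0 pi (fun t : R => appell_cos m k t * g t)).
  apply: eq_segint => t _; rewrite /g.
  have := polar_div t rrho; rewrite (polar_curl t rrho) => Ed.
  transitivity (appell_cos m k t * (cos t * (sin t ^+ m * (r * (polar au r t - polar bv r t))) +
    sin t ^+ m * (r * polar bv r t * cos t - r * polar bu r t * sin t))); first by ring.
  by rewrite Ed; ring.
by rewrite E; congr (- _); apply: eq_segint => t _; ring.
Qed.

(** Here the parts formula moves the angular derivative of [a] onto [sin^m b_k], and the boundary
    terms vanish because of [b_k]. *)
Lemma dsin_momentE k r : `|r| < rho ->
  r * dsin_moment k r = k%:R * cos_moment m k a r - m%:R * sin_moment m k b r.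
Proof.
move=> rrho.
have [cau cav] := continuous_polar_partials (vekua_a vk) rrho.
have [cbu cbv] := continuous_polar_partials (vekua_b vk) rrho.
have cb : continuous (polar b r) := continuous_polar (vekua_b vk) rrho.
have ca : continuous (polar a r) := continuous_polar (vekua_a vk) rrho.
have cc := @continuous_cos R; have cs := @continuous_sin R.
have csm := @continuous_sinX R m.
pose g t := polar au r t * (r * - sin t) + polar av r t * (r * cos t).
have cg : continuous g.
  have cNs : continuous (fun t : R => - sin t) by move=> t; apply: cvgN; exact: cs.
  by apply: continuousDr; apply: continuousMr => //; exact: continuousMl.
have Dg (t : R) : is_derive t 1 (polar a r) (g t).
  exact: (is_derive_polar_angle (vekua_a vk) t rrho).
have cf : continuous (fun t : R => k%:R * (sin t ^+ m * appell_cos m k t)).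
  by apply: continuousMl; apply: continuousMr => //; exact: continuous_appell_cos.
have := segint_by_parts (pi_gt0 R) cf cg (is_derive_weighted_appell_sin m k) Dg.
rewrite appell_sinpi appell_sin0 !mulr0 !mul0r subrr sub0r => E.
have cwa := @continuous_weight_cos k; have cws := @continuous_weight_sin k.
have cwm := continuousMr ca cwa; have cwn := continuousMr cb cws.
rewrite /dsin_moment -segintZ; last first.
  apply: continuousMr => //.
  by apply: continuousDr; exact: continuousMr.
rewrite /cos_moment /sin_moment -mulNr.
transitivity (segint 0 pi (fun t : R => -1 * (sin t ^+ m * appell_sin m k t * g t) +
    (- m%:R) * (polar b r t * (appell_sin m k t * sin t ^+ m)))).
  apply: eq_segint => t _; rewrite /g.
  have := polar_div t rrho; rewrite (polar_curl t rrho) => Ed.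
  (* The additional [sin t] comes from the radial derivative and restores the full weight
     [sin^m]. *)
  have Ed' : sin t * (sin t ^+ m * (r * (polar au r t - polar bv r t))) =
      m%:R * sin t ^+ m * polar b r t.
    by rewrite Ed; case: m => [|m'] /=; [rewrite !mul0r mulr0|rewrite exprS; ring].
  transitivity (appell_sin m k t * (r * (sin t ^+ m * (polar bu r t * cos t +
     polar au r t * sin t))) - appell_sin m k t *
     (sin t * (sin t ^+ m * (r * (polar au r t - polar bv r t))))); first by ring.
  by rewrite Ed'; ring.
have cwg : continuous (fun t => sin t ^+ m * appell_sin m k t * g t).
  exact: continuousMr (continuousMr csm (@continuous_appell_sin R m k)) cg.
rewrite [LHS]segint_lin // E mulN1r opprK; congr (_ + _).
by rewrite -segintZ //; apply: eq_segint => t _; ring.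
Qed.

End Moments.
End Vekua.

(** * Expansion of solutions of the Vekua system *)

Section AngularCompleteness.
Variable R : realType.
Implicit Types (h phi : R -> R) (t : R).

Lemma segint_fsum (a b : R) N (c : nat -> R) (f : nat -> R -> R) :
  (forall i, continuous (f i)) ->
  segint a b (fun t => \sum_(i < N) c i * f i t) =
  \sum_(i < N) c i * segint a b (f i).
Proof.
move=> cf; elim: N => [|N IH].
  transitivity (segint a b (fun t => 0 * f 0%N t)).
    by apply: eq_segint => t _; rewrite big_ord0 mul0r.
  by rewrite segintZ // mul0r big_ord0.
rewrite big_ord_recr /= -IH -[X in X + _]mul1r -segint_lin //.
  by apply: eq_segint => t _; rewrite big_ord_recr mul1r.
apply: (@continuous_fpartial _ (fun i t => c i * f i t)) => i.
exact: continuousMl.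
Qed.

Lemma eq0_closed_segment h : continuous h -> (forall t, 0 < t < pi -> h t = 0) ->
  forall t, 0 <= t <= pi -> h t = 0.
Proof.
move=> ch h0 t /andP[]; rewrite le_eqVlt => /predU1P[<- _|t0].
  by apply: (eq0_right_limit (pi_gt0 R) (ch 0)) => s; rewrite add0r; exact: h0.
rewrite le_eqVlt => /predU1P[->|tpi]; last by rewrite h0 ?t0.
by apply: (eq0_left_limit (pi_gt0 R) (ch pi)) => s; rewrite subrr; exact: h0.
Qed.

(** The closure hypothesis of [cos_span] and [sin_span], for continuous functions orthogonal to [h]
    with weight [w]. *)
Lemma weighted_span_lin h (w : R -> R) : continuous h -> continuous w ->
  forall (c d : R) (f g : R -> R),
  continuous f /\ segint 0 pi (fun t => h t * (f t * w t)) = 0 ->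
  continuous g /\ segint 0 pi (fun t => h t * (g t * w t)) = 0 ->
  continuous (fun t => c * f t + d * g t) /\
  segint 0 pi (fun t => h t * ((c * f t + d * g t) * w t)) = 0.
Proof.
move=> ch cw c d f g [cf f0] [cg g0]; split.
  by apply: continuousDr; exact: continuousMl.
transitivity (segint 0 pi (fun t => c * (h t * (f t * w t)) + d * (h t * (g t * w t)))).
  by apply: eq_segint => t _; ring.
rewrite segint_lin ?f0 ?g0 ?mulr0 ?addr0 //.
  exact: continuousMr ch (continuousMr cf cw).
exact: continuousMr ch (continuousMr cg cw).
Qed.

(** By triangularity [h sin^m] is orthogonal to all cosines, hence zero inside the segment, where
    [sin] is positive; continuity gives the endpoints. *)
Lemma appell_cos_complete m h : continuous h ->
  (forall k, segint 0 pi (fun t => h t * (appell_cos m k t * sin t ^+ m)) = 0) ->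
  forall t, 0 <= t <= pi -> h t = 0.
Proof.
move=> ch h0; have cw := @continuous_sinX R m.
have span := cos_span (weighted_span_lin ch cw)
  (fun k => conj (@continuous_appell_cos R m k) (h0 k)).
apply: eq0_closed_segment => // t tI.
have : h t * sin t ^+ m = 0.
  apply: (cos_complete (h := fun t => h t * sin t ^+ m)) tI => [|k].
    exact: continuousMr.
  by have [_ E0] := span k; rewrite -[RHS]E0; apply: eq_segint => s _; ring.
by move/eqP; rewrite mulf_eq0 expf_eq0 [sin t == 0]gt_eqF ?andbF ?orbF ?sin_gt0_pi //;
  move/eqP.
Qed.

(** Reduced to cosines by one more factor [sin t], because [sin t cos (k t)] is a combination of
    sines. *)
Lemma appell_sin_complete m h : continuous h ->
  (forall k, segint 0 pi (fun t => h t * (appell_sin m k t * sin t ^+ m)) = 0) ->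
  forall t, 0 <= t <= pi -> h t = 0.
Proof.
move=> ch h0; have cw := @continuous_sinX R m; have cs := @continuous_sin R.
have lin := weighted_span_lin ch cw.
have span := sin_span lin (fun k => conj (@continuous_appell_sin R m k) (h0 k)).
apply: eq0_closed_segment => // t tI.
have : h t * sin t ^+ m * sin t = 0.
  apply: (cos_complete (h := fun t => h t * sin t ^+ m * sin t)) tI => [|k].
    exact: continuousMr (continuousMr ch cw) cs.
  have E (x : R) : sin x * cos (k%:R * x) =
      2^-1 * sin (k.+1%:R * x) +
      (if k is k'.+1 then - 2^-1 * sin (k'%:R * x) else 2^-1 * sin (1%:R * x)).
    case: k => [|k]; first by rewrite mul0r cos0 !mul1r; field.
    have -> : k.+2%:R * x = k.+1%:R * x + x by rewrite -natr1; ring.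
    have -> : k%:R * x = k.+1%:R * x - x by rewrite -natr1; ring.
    by rewrite sinD sinB; field.
  have E0 : segint 0 pi (fun x : R => h x * ((2^-1 * sin (k.+1%:R * x) +
      (if k is 0%N then 2^-1 else - 2^-1) * sin ((if k is k'.+1 then k' else 1%N)%:R * x)) *
      sin x ^+ m)) = 0.
    by have [] := lin 2^-1 (if k is 0%N then 2^-1 else - 2^-1) _ _ (span k.+1)
      (span (if k is k'.+1 then k' else 1%N)).
  rewrite -[RHS]E0; apply: eq_segint => x _.
  transitivity (h x * ((sin x * cos (k%:R * x)) * sin x ^+ m)); first by ring.
  by rewrite E; case: (k).
move/eqP; rewrite !mulf_eq0 expf_eq0 [sin t == 0]gt_eqF ?andbF ?orbF ?sin_gt0_pi //.
by move/eqP.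
Qed.

(** The series has a continuous sum with the same moments as [p], so completeness identifies the
    two. Uniform convergence comes from the geometric bound, which is why no theory of mean-square
    convergence enters. *)
Lemma orthogonal_expansion (phi : nat -> R -> R) (w p : R -> R) (d : nat -> R)
    (C q : R) :
  (forall h, continuous h ->
     (forall k, segint 0 pi (fun t => h t * (phi k t * w t)) = 0) ->
     forall t, 0 <= t <= pi -> h t = 0) ->
  (forall k, continuous (phi k)) -> continuous w -> continuous p ->
  (forall j k, j != k -> segint 0 pi (fun t => phi j t * (phi k t * w t)) = 0) ->
  0 <= q < 1 -> (forall k t, `|d k * phi k t| <= C * q ^+ k) ->
  (forall k, segint 0 pi (fun t => p t * (phi k t * w t)) =
     d k * segint 0 pi (fun t => phi k t * (phi k t * w t))) ->
  forall t, 0 <= t <= pi -> series (fun k => d k * phi k t) @ \oo --> p t.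
Proof.
move=> complete cphi cw cp orth q01 uC mom t tI.
have cu k : continuous (fun t => d k * phi k t) by exact: continuousMl.
pose S := fseries (fun k t => d k * phi k t).
have cS : continuous S := continuous_fseries cu q01 uC.
suff <- : S t = p t by exact: (fseries_cvg q01 uC).
apply/eqP; rewrite eq_sym -subr_eq0; apply/eqP.
have := complete (fun t => 1 * p t + (-1) * S t).
rewrite -[in X in _ -> X]mulN1r -[X in _ -> X + _ = _]mul1r; apply => // [|k].
  by apply: continuousDr; exact: continuousMl.
have cwk := continuousMr (cphi k) cw.
transitivity (segint 0 pi (fun t => 1 * (p t * (phi k t * w t)) +
    (-1) * (S t * (phi k t * w t)))).
  by apply: eq_segint => x _; ring.
rewrite segint_lin; [|exact: continuousMr cp cwk|exact: continuousMr cS cwk].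
rewrite mom; set I := segint _ _ _.
rewrite (segint_fseries cu q01 uC (A := d k * I) (N0 := k.+1)) ?pi_ge0 //.
  by ring.
move=> N kN; transitivity (segint 0 pi (fun t => \sum_(i < N) d i *
    (phi i t * (phi k t * w t)))).
  by apply: eq_segint => x _; rewrite mulr_suml; apply: eq_bigr => i _; ring.
rewrite (segint_fsum _ _ _ d (f := fun i t => phi i t * (phi k t * w t))); last first.
  by move=> i; exact: continuousMr (cphi i) cwk.
rewrite (bigD1 (Ordinal kN)) //= big1 ?addr0 // => i ik.
by rewrite orth ?mulr0.
Qed.

End AngularCompleteness.

Section VekuaExpansion.
Variable R : realType.
Implicit Types (r s t x : R).

Section MomentHomogeneity.
Variables (m : nat) (rho M : R) (a au av b bu bv : R -> R -> R).
Hypothesis vk : vekua m rho a au av b bu bv.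
Hypothesis aM : forall u v, `|u| < rho -> `|v| < rho -> `|au u v| <= M /\ `|av u v| <= M.
Hypothesis bM : forall u v, `|u| < rho -> `|v| < rho -> `|bu u v| <= M /\ `|bv u v| <= M.

(* The combination k * alpha - (k + m) * beta of the two moments solves
   r y' = - (k + m) y and is regular at 0, hence vanishes: this discards the
   homogeneous solutions of negative degree. *)
Lemma moment_relation k r : 0 < r < rho ->
  k%:R * cos_moment m k a r = (k + m)%:R * sin_moment m k b r.
Proof.
move=> rI; case: k => [|k].
  rewrite mul0r add0n /sin_moment; transitivity (m%:R * segint 0 pi (fun=> 0 : R)).
    by rewrite segint_cst ?pi_ge0 // mul0r mulr0.
  by congr (_ * _); apply: eq_segint => t _; rewrite appell_sin_0 mul0r mulr0.
set K := k.+1.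
pose y x := K%:R * cos_moment m K a x + - (K + m)%:R * sin_moment m K b x.
suff : y r = 0 by rewrite /y mulNr => /eqP; rewrite subr_eq0 => /eqP.
have xr x : - rho < x < rho -> `|x| < rho by rewrite ltr_norml.
(* [(k + m).+1] is [K + m], the exponent of the integrating factor. The product is constant on an
   interval around [0], and it vanishes at [0]. *)
have D x : - rho < x < rho -> is_derive x 1 (fun x => y x * x ^+ (k + m).+1) 0.
  move=> /xr xrho.
  have D1 := is_derive_cos_moment vk aM K xrho.
  have D2 := is_derive_sin_moment vk bM K xrho.
  have D3 := is_derive_exprn (k + m) x.
  have D4 := is_deriveMl K%:R D1; have D5 := is_deriveMl (- (K + m)%:R) D2.
  have D6 : is_derive x 1 y (K%:R * dcos_moment m au av K x +
    - (K + m)%:R * dsin_moment m bu bv K x) by exact: is_deriveD.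
  apply: is_derive_eq; rewrite /GRing.scale /= exprS.
  have E1 := dcos_momentE vk K xrho; have E2 := dsin_momentE vk K xrho.
  transitivity (x ^+ (k + m) * (K%:R * (x * dcos_moment m au av K x) -
     (K + m)%:R * (x * dsin_moment m bu bv K x) + (k + m).+1%:R * y x)); first by ring.
  by rewrite E1 E2 /y -natr1 !natrD /K -natr1; ring.
have r0 : - rho < 0 < rho by lra.
have rr : - rho < r < rho by lra.
have := derive0_eq D rr r0; rewrite expr0n /= mulr0 => /eqP.
rewrite mulf_eq0 expf_eq0 /= => /orP[/eqP //|/eqP r00].
by move: rI; rewrite r00 ltxx.
Qed.

(** Substituting the relation between the moments turns the first equation into Euler's equation of
    degree [k]. *)
Lemma cos_moment_homogeneous k r s : 0 < r < rho -> 0 < s < rho ->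
  cos_moment m k a r * s ^+ k = cos_moment m k a s * r ^+ k.
Proof.
apply: (euler_homogeneous (df := dcos_moment m au av k)) => x xI.
have xrho : `|x| < rho by rewrite ger0_norm; lra.
split; first exact (is_derive_cos_moment vk aM k xrho).
by rewrite (dcos_momentE vk k xrho) moment_relation.
Qed.

End MomentHomogeneity.

Lemma vekua_shrink m rho e (a au av b bu bv : R -> R -> R) : e <= rho ->
  vekua m rho a au av b bu bv -> vekua m e a au av b bu bv.
Proof.
move=> er [va vb vc vd v0]; split=> [u v ue ve|u v ue ve|u v ue ve|u v ue ve|u ue].
- by apply: va; exact: lt_le_trans er.
- by apply: vb; exact: lt_le_trans er.
- by apply: vc; exact: lt_le_trans er.
- by apply: vd; exact: lt_le_trans er.
- by apply: v0; exact: lt_le_trans er.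
Qed.

Lemma cos_pairing_gt0 m k : 0 < cos_pairing R m k k.
Proof.
have [ka [la [ka0 la0 H]]] := cos_pairing_lower R m.
by apply: lt_le_trans (H k); rewrite mulr_gt0 ?exprn_gt0.
Qed.

(** The coefficient is read off from the cosine moment at one radius [s], and homogeneity carries it
    to all others. The relation between moments and [pairing_parts] yield the same coefficient for
    [b]. The lower bound of the pairings gives the growth rate [K = 1 / (s la)]. *)
Theorem vekua_expansion m rho (a au av b bu bv : R -> R -> R) : 0 < rho ->
  vekua m rho a au av b bu bv ->
  exists (c : nat -> R) (M K e : R), [/\ 0 < K, 0 < e,
    forall k, `|c k| <= M * K ^+ k &
    forall r t, 0 <= r < e -> 0 <= t <= pi ->
      series (fun k => c k * r ^+ k * appell_cos m k t) @ \oo --> polar a r t /\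
      series (fun k => c k * r ^+ k * appell_sin m k t) @ \oo --> polar b r t].
Proof.
move=> rho0 vk0.
have [e1 [M1 [e10 aM]]] := planar_C1_bound rho0 (vekua_a vk0).
have [e2 [M2 [e20 bM]]] := planar_C1_bound rho0 (vekua_b vk0).
pose e := Num.min rho (Num.min e1 e2).
have e0 : 0 < e by rewrite !lt_min rho0 e10 e20.
have vk : vekua m e a au av b bu bv.
  by apply: vekua_shrink vk0; rewrite ge_min lexx.
have {}aM u v : `|u| < e -> `|v| < e ->
    `|au u v| <= Num.max M1 M2 /\ `|av u v| <= Num.max M1 M2.
  rewrite !lt_min => /and3P[_ u1 _] /and3P[_ v1 _].
  by rewrite !le_max; have [-> ->] := aM u v u1 v1.
have {}bM u v : `|u| < e -> `|v| < e ->
    `|bu u v| <= Num.max M1 M2 /\ `|bv u v| <= Num.max M1 M2.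
  rewrite !lt_min => /and3P[_ _ u1] /and3P[_ _ v1].
  by rewrite !le_max; have [-> ->] := bM u v u1 v1; rewrite !orbT.
pose s := e / 2.
have sI : 0 < s < e by rewrite /s; lra.
have s0 : 0 < s by case/andP: sI.
have srho : `|s| < e by rewrite gtr0_norm; lra.
pose X k := cos_pairing R m k k.
have X0 k : 0 < X k := cos_pairing_gt0 m k.
pose c k := cos_moment m k a s / (s ^+ k * X k).
have momc k r : 0 < r < e -> cos_moment m k a r = c k * r ^+ k * X k.
  move=> rI; have := cos_moment_homogeneous vk aM bM k rI sI.
  move=> E; rewrite /c mulrAC -mulrA mulrC.
  have sk : s ^+ k != 0 by rewrite expf_neq0 // gt_eqF.
  have Xk : X k != 0 by rewrite gt_eqF.
  by apply: (mulIf sk); rewrite E; field; rewrite sk Xk.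
have [ka [la [ka0 la0 Xlow]]] := cos_pairing_lower R m.
pose A := segint 0 pi (fun t => `|polar a s t|).
have ca r : `|r| < e -> continuous (polar a r) := fun H => continuous_polar (vekua_a vk) H.
have cb r : `|r| < e -> continuous (polar b r) := fun H => continuous_polar (vekua_b vk) H.
pose K := (s * la)^-1.
have K0 : 0 < K by rewrite invr_gt0 mulr_gt0.
have cK k : `|c k| <= A / ka * K ^+ k.
  have -> : A / ka * K ^+ k = A / (s ^+ k * (ka * la ^+ k)).
    rewrite /K exprVn exprMn; field.
    by rewrite !expf_neq0 ?gt_eqF.
  rewrite normrM normfV; apply: ler_pM; rewrite ?invr_ge0 //.
    apply: norm_segint_le; rewrite ?pi_ge0 //.
    - exact: continuousMr (ca s srho) (@continuous_weight_cos R m k).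
    - by move=> t; apply: cvg_norm; exact: ca.
    - move=> t _; rewrite normrM -[leRHS]mulr1; apply: ler_wpM2l => //.
      exact: weight_cos_le1.
  rewrite gtr0_norm ?mulr_gt0 ?exprn_gt0 // lef_pV2 ?posrE ?mulr_gt0 ?exprn_gt0 //.
  by rewrite ler_pM2l ?exprn_gt0.
exists c, (A / ka), K, (Num.min e (K^-1 / 2)); split => //.
  by rewrite lt_min e0 divr_gt0 // invr_gt0.
move=> r t /andP[r0]; rewrite lt_min => /andP[re rK] tI.
have rrho : `|r| < e by rewrite ger0_norm.
have KX : K * r < 1.
  have : K * r < K * (K^-1 / 2) by rewrite ltr_pM2l.
  by rewrite mulrA divff ?gt_eqF // mul1r; lra.
have q01 : 0 <= K * r < 1 by rewrite mulr_ge0 ?(ltW K0).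
have momc0 k : cos_moment m k a r = c k * r ^+ k * X k.
  have [r1|r1] := ltP 0 r; first by apply: momc; rewrite r1.
  (* Homogeneity speaks of positive radii only; at [r = 0] the formula is obtained by continuity. *)
  have -> : r = 0 by apply/eqP; rewrite eq_le r0 r1.
  apply/eqP; rewrite -subr_eq0; apply/eqP.
  pose g x := cos_moment m k a x + (-1) * (c k * (x ^+ k * X k)).
  have D0 : {for 0, continuous (cos_moment m k a)}.
    apply/differentiable_continuous/derivable1_diffP.
    by case: (is_derive_cos_moment vk aM k (r := 0) _) => //; rewrite normr0.
  have -> : cos_moment m k a 0 - c k * 0 ^+ k * X k = g 0 by rewrite /g; ring.
  apply: (eq0_right_limit e0) => [|x]; last first.
    by rewrite add0r => xI; rewrite /g momc //; ring.
  apply: cvgD; first exact: D0.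
  have cX : continuous (fun x : R => -1 * (c k * (x ^+ k * X k))).
    do 2 apply: continuousMl; apply: continuousMr; last by move=> ?; exact: cvg_cst.
    exact: exprn_continuous.
  exact: cX.
have momb k : sin_moment m k b r = c k * r ^+ k * sin_pairing R m k k.
  case: k => [|k].
    transitivity (segint 0 pi (fun=> 0 : R)).
      by apply: eq_segint => x _; rewrite appell_sin_0 mul0r mulr0.
    rewrite segint_cst ?pi_ge0 // mul0r; symmetry.
    have -> : sin_pairing R m 0 0 = segint 0 pi (fun=> 0 : R).
      by apply: eq_segint => x _; rewrite appell_sin_0 mul0r.
    by rewrite segint_cst ?pi_ge0 // mul0r mulr0.
  have [r1|r1] := ltP 0 r; last first.
    have -> : r = 0 by apply/eqP; rewrite eq_le r0 r1.
    rewrite expr0n /= mulr0 mul0r; transitivity (segint 0 pi (fun=> 0 : R)).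
      apply: eq_segint => x _.
      by rewrite /polar !mul0r (vekua_b0 vk) ?normr0 // mul0r.
    by rewrite segint_cst ?pi_ge0 // mul0r.
  have km : (k.+1 + m)%:R != 0 :> R by rewrite pnatr_eq0.
  apply: (mulfI km); rewrite -(moment_relation vk aM bM) ?r1 //.
  by rewrite momc0 mulrCA /X pairing_parts mulrCA.
have ccos := @continuous_appell_cos R m; have csin := @continuous_appell_sin R m.
have uC (g : nat -> R -> R) : (forall k t, `|g k t| <= 1) ->
    forall k t, `|c k * r ^+ k * g k t| <= A / ka * (K * r) ^+ k.
  move=> g1 k x; rewrite normrM -[leRHS]mulr1; apply: ler_pM (g1 k x) => //.
  rewrite normrM exprMn mulrA normrX (ger0_norm r0).
  by apply: ler_wpM2r => //; rewrite exprn_ge0.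
split.
  apply: (orthogonal_expansion (@appell_cos_complete R m) ccos (@continuous_sinX R m)
    (ca r rrho) _ q01 (uC _ (@norm_appell_cos_le1 R m)) momc0 tI) => j k jk.
  by have [] := pairing_orth R m jk.
apply: (orthogonal_expansion (@appell_sin_complete R m) csin (@continuous_sinX R m)
  (cb r rrho) _ q01 (uC _ (@norm_appell_sin_le1 R m)) momb tI) => j k jk.
by have [] := pairing_orth R m jk.
Qed.

End VekuaExpansion.

(** * Power series *)

Section PowerSeries.
Variable R : realType.

(** The factor [k + 1] is absorbed by [2^k], so differentiation keeps geometric growth and can be
    iterated. *)
Lemma pseries_diffs_bound (c : nat -> R) (M K : R) : 0 <= K ->
  (forall k, `|c k| <= M * K ^+ k) ->
  forall k, `|pseries_diffs c k| <= M * K * (2 * K) ^+ k.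
Proof.
move=> K0 cM k; rewrite /pseries_diffs normrM normr_nat.
have M0 : 0 <= M by have := cM 0%N; rewrite expr0 mulr1; exact: le_trans.
apply: le_trans (ler_wpM2l _ (cM k.+1)) _ => //.
rewrite exprMn exprS.
have -> : k.+1%:R * (M * (K * K ^+ k)) = M * K * K ^+ k * k.+1%:R by ring.
have -> : M * K * (2 ^+ k * K ^+ k) = M * K * K ^+ k * 2 ^+ k by ring.
apply: ler_wpM2l; first by rewrite !mulr_ge0 ?exprn_ge0.
by rewrite -natrX ler_nat ltn_expl.
Qed.

Lemma is_cvg_pseries_bound (c : nat -> R) (M K x : R) : 0 < K ->
  (forall k, `|c k| <= M * K ^+ k) -> 0 <= x < K^-1 -> cvgn (pseries c x).
Proof.
move=> K0 cM /andP[x0 xK].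
have q01 : 0 <= K * x < 1.
  by rewrite mulr_ge0 ?(ltW K0) //= -(divff (lt0r_neq0 K0)) ltr_pM2l.
have H k : `|c k * x ^+ k| <= M * (K * x) ^+ k.
  rewrite normrM normrX (ger0_norm x0) exprMn mulrA.
  by apply: ler_wpM2r => //; rewrite exprn_ge0.
by have [] := geometric_tail q01 H.
Qed.

Lemma pseries_derive_near (g : R -> R) (c : nat -> R) (M K : R) : 0 < K ->
  (forall k, `|c k| <= M * K ^+ k) ->
  (\forall t \near (0 : R), series (fun k => c k * t ^+ k) @ \oo --> g t) ->
  \forall t \near (0 : R), derivable g t 1 /\
    series (fun k => pseries_diffs c k * t ^+ k) @ \oo --> 'D_1 g t.
Proof.
move=> K0 cM /nbhs_ballP[e /= e0 He].
have K2 : 0 < 2 * K by rewrite mulr_gt0.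
have K4 : 0 < 2 * (2 * K) by rewrite mulr_gt0.
have cM1 := pseries_diffs_bound (ltW K0) cM.
have cM2 := pseries_diffs_bound (ltW K2) cM1.
(* Termwise differentiation asks for convergence at [x0] of the series and of its first two formal
   derivatives, whose growth rates are [K], [2K] and [4K]. *)
pose x0 := (2 * (2 * (2 * K)))^-1.
have Kx : x0 = 8^-1 * K^-1 by rewrite /x0; field; rewrite gt_eqF.
have Ki : 0 < K^-1 by rewrite invr_gt0.
have x00 : 0 < x0 by rewrite Kx; lra.
have C0 : cvgn (pseries c x0) by apply: is_cvg_pseries_bound cM _ => //; lra.
have C1 : cvgn (pseries (pseries_diffs c) x0).
  by apply: is_cvg_pseries_bound cM1 _ => //; rewrite invfM; lra.
have C2 : cvgn (pseries (pseries_diffs (pseries_diffs c)) x0).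
  by apply: is_cvg_pseries_bound cM2 _ => //; rewrite !invfM; lra.
pose d := Num.min e x0.
have d0 : 0 < d by rewrite lt_min e0 x00.
apply/nbhs_ballP; exists d; first exact: d0.
move=> t; rewrite /ball /= sub0r normrN => td.
have tx0 : `|t| < `|x0|.
  by rewrite (gtr0_norm x00); apply: lt_le_trans td _; rewrite ge_min lexx orbT.
have D := pseries_snd_diffs C0 C1 C2 tx0.
have gE : \forall s \near t, limn (pseries c s) = g s.
  apply/nbhs_ballP; exists (d - `|t|) => /=; first by rewrite subr_gt0.
  move=> s; rewrite /ball /= => st; apply/cvg_lim => //; apply: He.
  rewrite /ball /= sub0r normrN.
  have : d <= e by rewrite ge_min lexx.
  have := ler_normD (s - t) t; rewrite subrK distrC in st *; lra.
have [Dg ->] := near_eq_is_derive gE D; split => //.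
exact: is_cvg_pseries_inside C1 tx0.
Qed.

Lemma derivable_near N (F : R -> 'rV[R]_N) (d : nat -> 'rV[R]_N) :
  (forall i, exists M K : R, 0 < K /\ forall k, `|d k ord0 i| <= M * K ^+ k) ->
  (forall i, \forall t \near (0 : R),
     series (fun k => d k ord0 i * t ^+ k) @ \oo --> F t ord0 i) ->
  \forall t \near (0 : R), derivable F t 1.
Proof.
move=> dM dF.
have H : \forall t \near (0 : R), forall k, derivable (fun s => F s ord0 k) t 1.
  apply: (@filter_forall R 'I_N (fun k t => derivable (fun s => F s ord0 k) t 1)
    (nbhs (0 : R))) => k.
  have [M [K [K0 dMK]]] := dM k.
  by have := pseries_derive_near K0 dMK (dF k); apply: filterS => t [].
by apply: filterS H => t Ht; apply/derivable_mxP => i k; rewrite (ord1 i).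
Qed.

(** Induction on [j], with [F] and [d] generalized: the derivative of [F] is again the sum of a
    series of geometric growth near [0], with coefficients [(k + 1) d_(k+1)]. *)
Lemma derive1n_pseries N j (F : R -> 'rV[R]_N) (d : nat -> 'rV[R]_N) :
  (forall i, exists M K : R, 0 < K /\ forall k, `|d k ord0 i| <= M * K ^+ k) ->
  (forall i, \forall t \near (0 : R),
     series (fun k => d k ord0 i * t ^+ k) @ \oo --> F t ord0 i) ->
  (\forall t \near (0 : R), derivable (derive1n j F) t 1) /\
  derive1n j F 0 = j`!%:R *: d j.
Proof.
elim: j F d => [|j IH] F d dM dF; last first.
  rewrite derive1Sn.
  have [||D0 ->] := IH F^`()%classic (fun k => k.+1%:R *: d k.+1).
  - move=> i; have [M [K [K0 /(pseries_diffs_bound (ltW K0)) H]]] := dM i.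
    exists (M * K), (2 * K); split; first by rewrite mulr_gt0.
    by move=> k; rewrite mxE; exact: H.
  - move=> i.
    have Fder := derivable_near dM dF.
    have [M [K [K0 dMK]]] := dM i.
    have S := pseries_derive_near K0 dMK (dF i).
    near=> t; have Ft : derivable F t 1 by near: t.
    rewrite derive1E derive_mx // mxE.
    have -> : (fun k => (k.+1%:R *: d k.+1) ord0 i * t ^+ k) =
        (fun k => pseries_diffs (fun k => d k ord0 i) k * t ^+ k).
      by apply/funext => k; rewrite mxE.
    suff [] : derivable (fun s => F s ord0 i) t 1 /\ series (fun k =>
      pseries_diffs (fun k => d k ord0 i) k * t ^+ k) @ \oo -->
      'D_1 (fun s => F s ord0 i) t by [].
    by near: t.
  - by split=> //; rewrite scalerA factS -natrM mulnC.
split; first exact: derivable_near dF.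
rewrite scale1r; apply/rowP => i; have := nbhs_singleton (dF i).
move=> /(cvg_lim (@Rhausdorff R)) <-; apply/cvg_lim => //.
(* The partial sum of index [0] is empty; all later ones equal [d 0], since [0 ^+ 0 = 1]. *)
rewrite -cvg_shiftS.
have -> : (fun n => series (fun k => d k ord0 i * 0 ^+ k) n.+1) = cst (d 0%N ord0 i).
  apply/funext => n; rewrite /series /= big_nat_recl //= expr0 mulr1.
  by rewrite big1 ?addr0 // => k _; rewrite expr0n mulr0.
exact: cvg_cst.
Unshelve. all: by end_near. Qed.

End PowerSeries.

(** * Clifford-Appell polynomials in polar form *)

Section CliffordAppell.
Variable R : realType.

Lemma cl_vecD n (w z : 'rV[R]_n) : cl_vec (w + z) = cl_vec w + cl_vec z.
Proof.
rewrite /cl_vec -big_split; apply: eq_bigr => i _ /=.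
by rewrite mxE scalerDl.
Qed.

Lemma cl_vecZ n (c : R) (w : 'rV[R]_n) : cl_vec (c *: w) = c *: cl_vec w.
Proof. by rewrite /cl_vec scaler_sumr; apply: eq_bigr => i _; rewrite mxE scalerA. Qed.

Lemma cl_vec0 n : cl_vec (0 : 'rV[R]_n) = 0.
Proof. by rewrite -(scale0r 0) cl_vecZ scale0r. Qed.

Lemma cl_vec_delta n (i : 'I_n) : cl_vec (delta_mx ord0 i : 'rV[R]_n) = gen R i.
Proof.
rewrite /cl_vec (bigD1 i) //= mxE !eqxx scale1r big1 ?addr0 // => j ji.
by rewrite mxE (negbTE ji) andbF scale0r.
Qed.

(** Twice the square is summed symmetrically, so that the mixed terms cancel in anticommuting
    pairs. *)
Lemma cl_vec_sq n (w : 'rV[R]_n) :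
  cl_vec w * cl_vec w = (- \sum_i w ord0 i ^+ 2)%:A.
Proof.
have E : cl_vec w * cl_vec w =
    \sum_i \sum_j (w ord0 i * w ord0 j) *: (gen R i * gen R j).
  rewrite /cl_vec mulr_suml; apply: eq_bigr => i _.
  rewrite mulr_sumr; apply: eq_bigr => j _.
  by rewrite -scalerAl -scalerAr scalerA.
have E2 : (2 : R) *: (cl_vec w * cl_vec w) = (2 : R) *: (- \sum_i w ord0 i ^+ 2)%:A.
  rewrite scaler_nat mulr2n {1}E E [X in _ + X]exchange_big -big_split /=.
  rewrite -sumrN scaler_suml scaler_sumr; apply: eq_bigr => i _.
  rewrite -big_split (bigD1 i) //= big1 ?addr0 => [|j ji].
    rewrite gen_sq -expr2 scalerN -scaleNr -scalerDl scalerA.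
    by congr (_ *: _); ring.
  by rewrite [w ord0 j * _]mulrC -scalerDr gen_anticomm ?scaler0 // eq_sym.
have two : (2 : R) != 0 by rewrite pnatr_eq0.
by rewrite -[LHS]scale1r -[RHS]scale1r -(mulVf two) -!scalerA E2.
Qed.

(** The exponential of [t w] when [w^2 = -1]; the two lemmas after it are its addition law and de
    Moivre's formula. *)
Definition cl_rot n (w : clifford R n) (t : R) : clifford R n :=
  (cos t)%:A + sin t *: w.

Lemma cl_rotD n (w : clifford R n) s t : w * w = -1 ->
  cl_rot w s * cl_rot w t = cl_rot w (s + t).
Proof.
move=> ww; rewrite /cl_rot cosD sinD scalerBl scalerDl mulrDl !mulrDr.
rewrite -!scalerAl -!scalerAr !mul1r !mulr1 ww !scalerA scalerN.
by rewrite -!addrA; congr (_ + _); rewrite addrC -!addrA addrCA; congr (_ + _).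
Qed.

Lemma cl_rotX n (w : clifford R n) t k : w * w = -1 ->
  cl_rot w t ^+ k = cl_rot w (k%:R * t).
Proof.
move=> ww; elim: k => [|k IH].
  by rewrite expr0 mul0r /cl_rot cos0 sin0 scale0r addr0 scale1r.
by rewrite exprS IH cl_rotD // -natr1; congr cl_rot; ring.
Qed.

Lemma paravectorE n u (w : 'rV[R]_n) : paravector (pt u w) = u%:A + cl_vec w.
Proof.
rewrite /paravector /re /vec /pt row_mxKr; congr (_%:A + _).
by rewrite mxE; case: splitP => // j _; rewrite (ord1 j) mxE eqxx.
Qed.

Lemma paravector_conjE n u (w : 'rV[R]_n) :
  paravector_conj (pt u w) = u%:A - cl_vec w.
Proof.
rewrite /paravector_conj /re /vec /pt row_mxKr; congr (_%:A - _).
by rewrite mxE; case: splitP => // j _; rewrite (ord1 j) mxE eqxx.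
Qed.

(** The paravector and its conjugate are [r] times the exponentials of [t I] and [- t I], so
    [x^(k-s)] times the [s]-th power of the conjugate is [r^k] times the rotation of angle
    [(k - 2s) t]. *)
Lemma clifford_appell_polar m k (I : 'rV[R]_m.+1) (r t : R) : sphere I ->
  clifford_appell k (pt (r * cos t) ((r * sin t) *: I)) =
  r ^+ k *: ((appell_cos m k t)%:A + appell_sin m k t *: cl_vec I).
Proof.
move=> SI; have ww : cl_vec I * cl_vec I = -1 by rewrite cl_vec_sq SI scaleN1r.
rewrite /clifford_appell paravectorE paravector_conjE cl_vecZ.
have -> : (r * cos t)%:A + (r * sin t) *: cl_vec I = r *: cl_rot (cl_vec I) t.
  by rewrite /cl_rot scalerDr !scalerA.
have -> : (r * cos t)%:A - (r * sin t) *: cl_vec I = r *: cl_rot (cl_vec I) (- t).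
  by rewrite /cl_rot cosN sinN scalerDr scaleNr scalerN !scalerA.
have -> : (appell_cos m k t)%:A + appell_sin m k t *: cl_vec I =
    \sum_(s < k.+1) appell_coef R m.+1 k s *:
      cl_rot (cl_vec I) ((k%:R - 2 * s%:R) * t).
  rewrite /appell_cos /appell_sin !scaler_suml -big_split; apply: eq_bigr => s _ /=.
  by rewrite /cl_rot scalerDr !scalerA.
rewrite scaler_sumr; apply: eq_bigr => -[s sk] _ /=; rewrite ltnS in sk.
have Er : r ^+ k = r ^+ (k - s) * r ^+ s by rewrite -exprD subnK.
rewrite !exprZn -scalerAl -scalerAr !cl_rotX // cl_rotD // !scalerA.
congr (_ *: cl_rot _ _); first by rewrite Er; ring.
by rewrite natrB //; ring.
Qed.

Lemma clifford_appell_real m k (t : R) :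
  clifford_appell k (pt t (0 : 'rV[R]_m.+1)) = (t ^+ k)%:A.
Proof.
rewrite /clifford_appell paravectorE paravector_conjE cl_vec0 addr0 subr0.
transitivity (\sum_(s < k.+1) (appell_coef R m.+1 k s *: (t ^+ k)%:A) : clifford R m.+1).
  apply: eq_bigr => -[s sk] _ /=; rewrite ltnS in sk; congr (_ *: _).
  by rewrite -exprD subnK // exprZn expr1n.
by rewrite -scaler_suml appell_coef_sum scale1r.
Qed.

End CliffordAppell.

(** * Linear functionals on the Clifford algebra *)

Section LinearFunctionals.
Variables (R : realType) (n : nat).
Implicit Types (x y : clifford R n).

(** More general than the coordinates: functionals such as [coef C (x * y)] in [y], with [x] fixed,
    are needed as well. *)
Definition cl_linear (L : clifford R n -> R) :=
  forall (a : R) x y, L (a *: x + y) = a * L x + L y.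

Section Linear.
Variable L : clifford R n -> R.
Hypothesis linL : cl_linear L.

Lemma cl_linear0 : L 0 = 0.
Proof. by have := linL (-1) 0 0; rewrite scaler0 addr0; lra. Qed.

Lemma cl_linearZ a x : L (a *: x) = a * L x.
Proof. by rewrite -[a *: x]addr0 linL cl_linear0 addr0. Qed.

Lemma cl_linearD x y : L (x + y) = L x + L y.
Proof. by rewrite -{1}[x]scale1r linL mul1r. Qed.

Lemma cl_linearN x : L (- x) = - L x.
Proof. by rewrite -scaleN1r cl_linearZ mulN1r. Qed.

Lemma cl_linear_coef x : L x = \sum_A coef A x * L (blade R A).
Proof.
rewrite {1}(cl_sumE x) (big_morph L cl_linearD cl_linear0).
by apply: eq_bigr => A _; rewrite cl_linearZ.
Qed.

Lemma cl_linear_continuous : continuous L.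
Proof.
have -> : L = fun x => \sum_A coef A x * L (blade R A).
  by apply/funext => x; exact: cl_linear_coef.
apply: continuous_big; first exact: add_continuous.
move=> A _ x.
have cA : {for x, continuous (@coef R n A)}.
  exact: (@coord_continuous R 1 _ ord0 (enum_rank A) x).
exact: (cvgM cA (cvg_cst (L (blade R A)))).
Qed.

Lemma is_derive_cl_linear (V : normedModType R) (F : V -> clifford R n) (x v : V) dF :
  is_derive x v F dF -> is_derive x v (L \o F) (L dF).
Proof.
move=> [dFx <-]; set l := 'D_v F x.
have H : h^-1 *: ((L \o F) (h *: v + x) - (L \o F) x) @[h --> 0^'] --> L l.
  have -> : (fun h : R => h^-1 *: ((L \o F) (h *: v + x) - (L \o F) x)) =
      L \o (fun h => h^-1 *: (F (h *: v + x) - F x)).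
    apply/funext => h /=; rewrite cl_linearZ cl_linearD cl_linearN.
    by rewrite mulrBr scalerBr.
  by apply: continuous_cvg; [exact: cl_linear_continuous|exact: dFx].
by apply: DeriveDef; [apply/cvg_ex; exists (L l)|exact: cvg_lim].
Qed.

End Linear.

Lemma cl_linear_coefE A : cl_linear (coef A).
Proof. by move=> a x y; rewrite Defs.coefD Defs.coefZ. Qed.

Lemma cl_linear_mul L (c : R) w : cl_linear L -> cl_linear (fun x => L (c *: (w * x))).
Proof.
move=> lL a x y; rewrite mulrDr -scalerAr scalerDr cl_linearD //; congr (_ + _).
by rewrite scalerA mulrC -scalerA cl_linearZ.
Qed.

Lemma cl_linear_scale L (c : R) : cl_linear L -> cl_linear (fun x => L (c *: x)).
Proof.
by move=> lL; have := cl_linear_mul c 1 lL; congr cl_linear; apply/funext => x; rewrite mul1r.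
Qed.

End LinearFunctionals.

(** * Points, Euclidean norm and lines *)

Section Points.
Variables (R : realType) (n : nat).
Implicit Types (u v t : R) (w z : 'rV[R]_n).

Lemma ptD u v w z : pt u w + pt v z = pt (u + v) (w + z).
Proof. by rewrite /pt add_row_mx raddfD. Qed.

Lemma ptZ (c : R) u w : c *: pt u w = pt (c * u) (c *: w).
Proof. by rewrite /pt scale_row_mx scale_scalar_mx. Qed.

Lemma re_pt u w : re (pt u w) = u.
Proof.
by rewrite /re /pt mxE; case: splitP => // j _; rewrite (ord1 j) mxE eqxx.
Qed.

Lemma vec_pt u w : vec (pt u w) = w.
Proof. exact: row_mxKr. Qed.

Lemma pt_re_vec (x : 'rV[R]_(1 + n)) : pt (re x) (vec x) = x.
Proof.
rewrite /pt /re /vec -[RHS]hsubmxK; congr row_mx.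
apply/rowP => i; rewrite (ord1 i) !mxE eqxx mulr1n; congr (x _ _).
exact/val_inj.
Qed.

Lemma basis_vec_re : basis_vec R (lshift n ord0) = pt 1 (0 : 'rV[R]_n).
Proof.
apply/rowP => i; rewrite !mxE eqxx /=; case: splitP => j ij.
  by rewrite (ord1 j) mxE eqxx -(inj_eq val_inj) /= ij (ord1 j).
by rewrite mxE -(inj_eq val_inj) /= ij.
Qed.

Lemma basis_vec_vec i : basis_vec R (rshift 1 i) = pt 0 (delta_mx ord0 i : 'rV[R]_n).
Proof.
apply/rowP => k; rewrite !mxE eqxx /=; case: splitP => j kj.
  by rewrite (ord1 j) mxE eqxx -(inj_eq val_inj) /= kj (ord1 j).
by rewrite mxE eqxx -!(inj_eq val_inj) /= kj eqn_add2l.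
Qed.

Lemma enorm_ge0 w : 0 <= enorm w.
Proof. exact: sqrtr_ge0. Qed.

Lemma enorm_sq w : enorm w ^+ 2 = \sum_i w ord0 i ^+ 2.
Proof. by rewrite sqr_sqrtr // sumr_ge0 // => i _; rewrite sqr_ge0. Qed.

Lemma enormZ (c : R) w : enorm (c *: w) = `|c| * enorm w.
Proof.
rewrite /enorm -sqrtr_sqr -sqrtrM ?sqr_ge0 //; congr Num.sqrt.
by rewrite mulr_sumr; apply: eq_bigr => i _; rewrite mxE exprMn.
Qed.

Lemma enorm_sphere w : sphere w -> enorm w = 1.
Proof. by move=> Sw; rewrite /enorm Sw sqrtr1. Qed.

Lemma coord_le_enorm w i : `|w ord0 i| <= enorm w.
Proof.
rewrite -(ler_pXn2r (_ : 0 < 2)%N) ?nnegrE ?enorm_ge0 // enorm_sq.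
rewrite real_normK ?num_real // (bigD1 i) //= lerDl sumr_ge0 // => j _.
exact: sqr_ge0.
Qed.

Lemma sphere_delta i : sphere (delta_mx ord0 i : 'rV[R]_n).
Proof.
rewrite /sphere /= (bigD1 i) //= mxE !eqxx expr1n big1 ?addr0 // => j ji.
by rewrite mxE (negbTE ji) andbF expr0n.
Qed.

Lemma sphereN w : sphere w -> sphere (- w).
Proof.
by rewrite /sphere /= => <-; apply: eq_bigr => i _; rewrite mxE sqrrN.
Qed.

Lemma sphere_normalize w : 0 < enorm w -> sphere ((enorm w)^-1 *: w).
Proof.
move=> w0; rewrite /sphere /= -enorm_sq enormZ normfV gtr0_norm // mulVf ?gt_eqF //.
by rewrite expr1n.
Qed.

(** Balls are those of the sup norm, and every coordinate is bounded by the Euclidean norm. *)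
Lemma nbhs_pt (U : set 'rV[R]_(1 + n)) : nbhs (0 : 'rV[R]_(1 + n)) U ->
  exists2 rho : R, 0 < rho & forall u w, `|u| < rho -> enorm w < rho -> U (pt u w).
Proof.
move=> /nbhs_ballP[rho /= rho0 HU]; exists rho => // u w urho wrho.
apply: HU; split=> // i j; rewrite /ball /= (ord1 i) !mxE sub0r normrN.
case: splitP => k _; first by rewrite (ord1 k) mxE eqxx.
exact: le_lt_trans (coord_le_enorm w k) wrho.
Qed.

Lemma is_derive_line (V : normedModType R) (f : 'rV[R]_(1 + n) -> V)
    (p : R -> 'rV[R]_(1 + n)) (v : 'rV[R]_(1 + n)) (u : R) df :
  (forall h, p (h + u) = h *: v + p u) -> is_derive (p u) v f df ->
  is_derive u 1 (f \o p) df.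
Proof.
move=> pE [dfp <-].
have E : (fun h : R => h^-1 *: ((f \o p) (h *: (1 : R) + u) - (f \o p) u)) =
    (fun h => h^-1 *: (f (h *: v + p u) - f (p u))).
  by apply/funext => h /=; rewrite -pE [h *: 1]mulr1.
by apply: DeriveDef; rewrite /derivable /derive E.
Qed.

End Points.

(** * Axially monogenic functions on a half-plane *)

Section AxialPlane.
Variables (R : realType) (m : nat).
Variables (U : set 'rV[R]_(1 + m.+1)) (f : 'rV[R]_(1 + m.+1) -> clifford R m.+1).
Hypothesis f_axial : axially_monogenic U f.
Variable rho : R.
Hypothesis rhoU : forall u (w : 'rV[R]_m.+1), `|u| < rho -> enorm w < rho -> U (pt u w).
Implicit Types (u v t : R).

Let e1 : 'rV[R]_m.+1 := delta_mx ord0 ord0.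
Let g1 : clifford R m.+1 := gen R ord0.
Let Df i : 'rV[R]_(1 + m.+1) -> clifford R m.+1 := 'D_(basis_vec R i) f.
Let D0 := Df (lshift m.+1 ord0).
Let Dv (j : 'I_m.+1) := Df (rshift 1 j).

Definition plane_pt u v : 'rV[R]_(1 + m.+1) := pt u (v *: e1).

(** [A] and [B] are rebuilt from the values of [f] in the plane of [1] and [e_1], so that they
    inherit the C^1 regularity of [f]. In [odd_part], left multiplication by [- g1] inverts [g1]. *)
Definition even_part u v : clifford R m.+1 :=
  2^-1 *: (f (plane_pt u v) + f (plane_pt u (- v))).
Definition odd_part u v : clifford R m.+1 :=
  - 2^-1 *: (g1 * (f (plane_pt u v) - f (plane_pt u (- v)))).

Lemma U_line u v (I : 'rV[R]_m.+1) : sphere I -> `|u| < rho -> `|v| < rho ->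
  U (pt u (v *: I)).
Proof. by move=> SI ur vr; apply: rhoU => //; rewrite enormZ (enorm_sphere SI) mulr1. Qed.

Lemma U_plane u v : `|u| < rho -> `|v| < rho -> U (plane_pt u v).
Proof. exact/U_line/sphere_delta. Qed.

Lemma g1_sq : g1 * g1 = -1.
Proof. exact: gen_sq. Qed.

(** The representation formula: the axial form at [e_1] and [- e_1] is a pair of equations that
    determines [A] and [B]. *)
Lemma axial_formula u v (I : 'rV[R]_m.+1) : sphere I -> `|u| < rho -> 0 <= v < rho ->
  f (pt u (v *: I)) = even_part u v + cl_vec I * odd_part u v.
Proof.
move=> SI ur /andP[]; rewrite le_eqVlt => /predU1P[<- r0|v0 vr].
  rewrite /even_part /odd_part /plane_pt oppr0 !scale0r subrr mulr0 scaler0 mulr0 addr0.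
  by rewrite scalerDr -scalerDl -[LHS]scale1r; congr (_ *: _); field.
have vn : `|v| < rho by rewrite gtr0_norm.
have [_ _ [A [B [_ AB]]]] := f_axial.
have F (J : 'rV[R]_m.+1) : sphere J -> f (pt u (v *: J)) = A u v + cl_vec J * B u v.
  move=> SJ; rewrite AB; last exact: U_line.
  rewrite re_pt vec_pt enormZ (enorm_sphere SJ) mulr1 gtr0_norm //.
  rewrite /omega vec_pt enormZ (enorm_sphere SJ) mulr1 gtr0_norm //.
  by rewrite scalerA mulVf ?gt_eqF // scale1r.
have Fp := F _ (sphere_delta R (ord0 : 'I_m.+1)).
have := F _ (sphereN (sphere_delta R (ord0 : 'I_m.+1))).
rewrite scalerN -scaleNr -[- delta_mx _ _]scaleN1r cl_vecZ scaleN1r => Fm.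
rewrite F // /even_part /odd_part /plane_pt Fp Fm cl_vec_delta -/g1.
have -> : A u v + g1 * B u v + (A u v + - g1 * B u v) = (2 : R) *: A u v.
  by rewrite addrACA mulNr subrr addr0 scaler_nat mulr2n.
have -> : A u v + g1 * B u v - (A u v + - g1 * B u v) = (2 : R) *: (g1 * B u v).
  by rewrite opprD addrACA subrr add0r mulNr opprK scaler_nat mulr2n.
have -> : - 2^-1 *: (g1 * ((2 : R) *: (g1 * B u v))) = B u v.
  rewrite -scalerAr mulrA g1_sq mulN1r scalerA scalerN -scaleNr.
  by rewrite -[RHS]scale1r; congr (_ *: _); field.
by rewrite scalerA mulVf ?pnatr_eq0 // scale1r.
Qed.

Lemma planar_C1_plane L : cl_linear L ->
  planar_C1 rho (fun u v => L (f (plane_pt u v))) (fun u v => L (D0 (plane_pt u v)))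
    (fun u v => L (Dv ord0 (plane_pt u v))).
Proof.
move=> lL u v ur vr; have [_ [C1 _] _] := f_axial.
have Up := U_plane ur vr.
have cP : {for (u, v), continuous (fun z : R * R => plane_pt z.1 z.2)}.
  have -> : (fun z : R * R => plane_pt z.1 z.2) =
      (fun z : R * R => z.1 *: pt 1 0 + z.2 *: pt 0 e1).
    by apply/funext => z; rewrite !ptZ ptD scaler0 mulr1 mulr0 addr0 add0r.
  have k1 (x : 'rV[R]_(1 + m.+1)) : {for (u, v), continuous (fun z : R * R => z.1 *: x)}.
    exact: (cvgZ (@cvg_fst _ _ (nbhs u) (nbhs v) _) (cvg_cst x)).
  have k2 (x : 'rV[R]_(1 + m.+1)) : {for (u, v), continuous (fun z : R * R => z.2 *: x)}.
    exact: (cvgZ (@cvg_snd _ _ (nbhs u) (nbhs v) _) (cvg_cst x)).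
  exact: (cvgD (k1 (pt 1 0)) (k2 (pt 0 e1))).
have cD i : {for (u, v), continuous (fun z : R * R => L (Df i (plane_pt z.1 z.2)))}.
  have [_ cDi] := C1 i _ Up.
  have cL : {for Df i (plane_pt u v), continuous L}.
    exact: cl_linear_continuous.
  exact: (continuous_comp (g := L) (continuous_comp (g := Df i) cP cDi) cL).
have Di i : is_derive (plane_pt u v) (basis_vec R i) f (Df i (plane_pt u v)).
  by have [Dx _] := C1 i _ Up; exact: DeriveDef.
split; [| |exact: cD|exact: cD].
  apply: (is_derive_cl_linear lL (F := f \o (plane_pt ^~ v))).
  apply: (is_derive_line (p := plane_pt ^~ v) _ (Di _)) => h.
  by rewrite basis_vec_re /plane_pt ptZ ptD scaler0 add0r mulr1.
apply: (is_derive_cl_linear lL (F := f \o plane_pt u)).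
apply: (is_derive_line (p := plane_pt u) _ (Di _)) => h.
by rewrite basis_vec_vec /plane_pt ptZ ptD mulr0 add0r scalerDl.
Qed.

(** Used with [c = 1] and [c = -1] for the even and odd parts in [v]. *)
Lemma planar_C1_sym (phi phiu phiv : R -> R -> R) (c : R) :
  planar_C1 rho phi phiu phiv ->
  planar_C1 rho (fun u v => phi u v + c * phi u (- v))
    (fun u v => phiu u v + c * phiu u (- v))
    (fun u v => phiv u v - c * phiv u (- v)).
Proof.
move=> H u v ur vr; have [D1 D2 c1 c2] := H _ _ ur vr.
have vr' : `|- v| < rho by rewrite normrN.
have [D1' D2' c1' c2'] := H _ _ ur vr'.
have cN : {for (u, v), continuous (fun z : R * R => (z.1, - z.2))}.
  exact: (cvg_pair (@cvg_fst _ _ (nbhs u) (nbhs v) _)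
    (cvgN (@cvg_snd _ _ (nbhs u) (nbhs v) _))).
have cc (g : R -> R -> R) : {for (u, - v), continuous (fun z : R * R => g z.1 z.2)} ->
    {for (u, v), continuous (fun z : R * R => c * g z.1 (- z.2))}.
  move=> cg.
  exact: (cvgM (cvg_cst c) (continuous_comp (g := fun z : R * R => g z.1 z.2) cN cg)).
have DN : is_derive v 1 (fun x : R => - x) (-1) := is_deriveN (is_derive_id v (1 : R)).
have E := is_derive_comp1 DN D2'.
split.
- by have := is_deriveMl c D1' => D3; apply: is_derive_eq.
- have D3 := is_deriveMl c E; apply: is_derive_eq.
  by congr (_ + _); ring.
- exact: (cvgD c1 (cc _ c1')).
- exact: (cvgB c2 (cc _ c2')).
Qed.

Lemma planar_even L : cl_linear L ->
  planar_C1 rho (fun u v => L (even_part u v))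
    (fun u v => L (2^-1 *: (D0 (plane_pt u v) + D0 (plane_pt u (- v)))))
    (fun u v => L (2^-1 *: (Dv ord0 (plane_pt u v) - Dv ord0 (plane_pt u (- v))))).
Proof.
move=> lL; have lL2 := cl_linear_scale 2^-1 lL.
have := planar_C1_sym 1 (planar_C1_plane lL2).
congr planar_C1; apply/funext => u; apply/funext => v; rewrite mul1r.
- by rewrite -(cl_linearD lL2).
- by rewrite -(cl_linearD lL2).
- by rewrite -(cl_linearN lL2) -(cl_linearD lL2).
Qed.

Lemma planar_odd L : cl_linear L ->
  planar_C1 rho (fun u v => L (odd_part u v))
    (fun u v => L (- 2^-1 *: (g1 * (D0 (plane_pt u v) - D0 (plane_pt u (- v))))))
    (fun u v => L (- 2^-1 *: (g1 * (Dv ord0 (plane_pt u v) + Dv ord0 (plane_pt u (- v)))))).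
Proof.
move=> lL; have lL2 := cl_linear_mul (- 2^-1) g1 lL.
have := planar_C1_sym (-1) (planar_C1_plane lL2).
congr planar_C1; apply/funext => u; apply/funext => v; rewrite mulN1r ?opprK.
- by rewrite -(cl_linearN lL2) -(cl_linearD lL2).
- by rewrite -(cl_linearN lL2) -(cl_linearD lL2).
- by rewrite -(cl_linearD lL2).
Qed.

Lemma odd_part0 u : odd_part u 0 = 0.
Proof. by rewrite /odd_part oppr0 subrr mulr0 scaler0. Qed.

Lemma odd_partN u v : odd_part u (- v) = - odd_part u v.
Proof. by rewrite /odd_part opprK -opprB mulrN scalerN. Qed.

(* Moving orthogonally to the plane changes the distance w to the real axis
   only to second order, so that only the direction of the vector part varies. *)
Lemma transverse_derivative u v (I : 'rV[R]_m.+1) (j : 'I_m.+1) :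
  sphere I -> I ord0 j = 0 -> `|u| < rho -> 0 < v < rho ->
  Dv j (pt u (v *: I)) = v^-1 *: (gen R j * odd_part u v).
Proof.
move=> SI Ij ur /andP[v0 vr].
have vr' : `|v| < rho by rewrite gtr0_norm.
apply: cliffordP => C; have lC : cl_linear (@coef R m.+1 C) := @cl_linear_coefE R m.+1 C.
have [_ [C1 _] _] := f_axial; have Up := U_line SI ur vr'.
pose p t := pt u (v *: I + t *: delta_mx ord0 j).
have p0 : p 0 = pt u (v *: I) by rewrite /p scale0r addr0.
have Dp : is_derive (p 0) (basis_vec R (rshift 1 j)) f (Dv j (pt u (v *: I))).
  by rewrite p0; have [Dx _] := C1 (rshift 1 j) _ Up; exact: DeriveDef.
have Dfp : is_derive (0 : R) 1 (f \o p) (Dv j (pt u (v *: I))).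
  apply: (is_derive_line (p := p) _ Dp) => h.
  by rewrite basis_vec_vec /p ptZ ptD mulr0 !addr0 add0r scale0r addr0 addrC.
have DL := is_derive_cl_linear lC Dfp.
(* Distance to the real axis along the path: [I] is orthogonal to the direction [j]. *)
pose w t : R := Num.sqrt (v ^+ 2 + t ^+ 2).
have w0 : w 0 = v by rewrite /w expr0n addr0 sqrtr_sqr gtr0_norm.
have enp t : enorm (v *: I + t *: delta_mx ord0 j) = w t.
  rewrite /enorm /w; congr Num.sqrt; rewrite (bigD1 j) //= !mxE Ij !eqxx mulr0 add0r mulr1 addrC.
  congr (_ + _); rewrite -[RHS]mulr1 -(SI : \sum_i _ = 1) mulr_sumr [RHS](bigD1 j) //=.
  rewrite Ij expr0n mulr0 add0r; apply: eq_bigr => i ij.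
  by rewrite !mxE (negbTE ij) andbF mulr0 addr0 exprMn.
have Dw : is_derive (0 : R) 1 w 0.
  have Ds : is_derive (0 : R) 1 (fun t : R => v ^+ 2 + t ^+ 2) 0.
    have D2 := is_derive_exprn 1 (0 : R).
    by have := is_deriveD (is_derive_cst (v ^+ 2) (0 : R) 1) D2; rewrite expr1 mulr0 addr0.
  have v2 : 0 < v ^+ 2 + 0 ^+ 2 :> R by rewrite expr0n /= addr0 exprn_gt0.
  have := is_derive_comp1 Ds (is_derive1_sqrt v2); rewrite mulr0; exact.
have Vr : 0 < v < rho by rewrite v0 vr.
pose b1 s := coef C (cl_vec I * odd_part u s).
pose b2 s := coef C (gen R j * odd_part u s).
have lM (x : clifford R m.+1) : cl_linear (fun y : clifford R m.+1 => coef C (x * y)).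
  have := cl_linear_mul 1 x lC; congr cl_linear; apply/funext => y.
  by rewrite scale1r.
have [_ Da _ _] := planar_even lC ur vr'.
have [_ Db1 _ _] := planar_odd (lM (cl_vec I)) ur vr'.
have [_ Db2 _ _] := planar_odd (lM (gen R j)) ur vr'.
(* The direction of the vector part is [(v I + t e_j) / w]. As [w] has zero derivative at [0], only
   the explicit factor [t] contributes, and [b2 v / v] remains. *)
have E : \forall t \near (0 : R), coef C (even_part u (w t)) +
    (w t)^-1 * (v * b1 (w t) + t * b2 (w t)) = (coef C \o (f \o p)) t.
  have cw : {for 0, continuous w}.
    by apply/differentiable_continuous/derivable1_diffP; case: Dw.
  have wr : \forall t \near (0 : R), w t < rho.
    by apply: cvgr_lt cw _ _; rewrite w0.
  apply: filterS wr => t wr /=.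
  have wt0 : 0 < w t by rewrite sqrtr_gt0 ltr_wpDr ?sqr_ge0 ?exprn_gt0.
  have wr' : 0 <= w t < rho by rewrite wr ltW.
  have St : sphere ((w t)^-1 *: (v *: I + t *: delta_mx ord0 j)).
    by rewrite -enp; apply: sphere_normalize; rewrite enp.
  have := axial_formula St ur wr'; rewrite scalerA divff ?gt_eqF // scale1r => ->.
  rewrite (cl_linearD lC) cl_vecZ cl_vecD !cl_vecZ cl_vec_delta; congr (_ + _).
  by rewrite -scalerAl mulrDl -!scalerAl (cl_linearZ lC) (cl_linearD lC) !(cl_linearZ lC).
have wv : w 0 != 0 by rewrite w0 gt_eqF.
rewrite -w0 in Da Db1 Db2.
have Da' := is_derive_comp1 Dw Da.
have Db1' := is_derive_comp1 Dw Db1.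
have Db2' := is_derive_comp1 Dw Db2.
have DV := is_deriveV wv Dw.
have Did : is_derive (0 : R) 1 (fun t : R => t) 1 by exact: is_derive_id.
have Dt := is_deriveM Did Db2'.
have Dvb := is_deriveMl v Db1'.
have Dsum := is_deriveM DV (is_deriveD Dvb Dt).
have Dtot := is_deriveD Da' Dsum.
have DT := near_eq_is_derive E Dtot.
rewrite (cl_linearZ lC); transitivity ('D_1 (coef C \o (f \o p)) 0).
  by case: DL => _ ->.
case: DT => _ ->; rewrite /GRing.scale /= !(mulr0, mul0r, add0r, addr0, mulr1).
by rewrite /b2 w0.
Qed.

(** Since [e_j^2 = -1], each of the [m] transverse directions contributes [- odd_part / v]. At
    [v = 0] only [m = 0] is allowed, and the sum is empty. *)
Lemma transverse_sum u v : `|u| < rho -> `|v| < rho -> (v != 0) || (m == 0%N) ->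
  \sum_(j < m) gen R (lift ord0 j) * Dv (lift ord0 j) (plane_pt u v) =
  - (m%:R / v) *: odd_part u v.
Proof.
move=> ur vr; have [-> /= /eqP m0|vn0 _] := eqVneq v 0.
  rewrite invr0 mulr0 oppr0 scale0r; apply: big1 => j _.
  by have := ltn_ord j; rewrite [X in (_ < X)%N]m0.
have tm (j : 'I_m) : gen R (lift ord0 j) * Dv (lift ord0 j) (plane_pt u v) =
    - v^-1 *: odd_part u v.
  have e1j : e1 ord0 (lift ord0 j) = 0 by rewrite /e1 mxE.
  have Se1 : sphere e1 := sphere_delta R (ord0 : 'I_m.+1).
  suff -> : Dv (lift ord0 j) (plane_pt u v) = v^-1 *: (gen R (lift ord0 j) * odd_part u v).
    by rewrite -scalerAr mulrA gen_sq mulN1r scalerN scaleNr.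
  have [v0|v0] := ltP 0 v.
    apply: transverse_derivative => //.
    by rewrite v0 -(gtr0_norm v0).
  (* A point with [v < 0] lies at distance [- v] in the direction [- e_1]. *)
  have v0' : 0 < - v by rewrite oppr_gt0 lt_neqAle vn0.
  have -> : plane_pt u v = pt u (- v *: (- e1)) by rewrite /plane_pt scalerN scaleNr opprK.
  have e1jN : (- e1) ord0 (lift ord0 j) = 0 by rewrite mxE e1j oppr0.
  have vI : 0 < - v < rho by rewrite v0' -(gtr0_norm v0') normrN.
  rewrite (transverse_derivative (sphereN Se1) e1jN ur vI).
  by rewrite odd_partN invrN mulrN scalerN scaleNr opprK.
rewrite (eq_bigr (fun=> - v^-1 *: odd_part u v)) => [|j _]; last exact: tm.
by rewrite sumr_const card_ord -scaler_nat scalerA mulrN.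
Qed.

Lemma cauchy_riemann_plane u v : `|u| < rho -> `|v| < rho -> (v != 0) || (m == 0%N) ->
  D0 (plane_pt u v) + g1 * Dv ord0 (plane_pt u v) = (m%:R / v) *: odd_part u v.
Proof.
move=> ur vr vm; have [_ [_ CR] _] := f_axial.
have := CR _ (U_plane ur vr); rewrite /cauchy_riemann big_ord_recl.
rewrite (transverse_sum ur vr vm) addrA scaleNr => /eqP.
by rewrite subr_eq0 => /eqP.
Qed.

(** [odd_part / v] is even in [v], so the Cauchy-Riemann equations at [v] and [- v] have the same
    right-hand side. Their difference, multiplied by [g1], is the curl equation; their half-sum is
    the divergence equation. *)
Lemma vekua_coef (C : {set 'I_m.+1}) : vekua m rho
  (fun u v => coef C (even_part u v))
  (fun u v => coef C (2^-1 *: (D0 (plane_pt u v) + D0 (plane_pt u (- v)))))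
  (fun u v => coef C (2^-1 *: (Dv ord0 (plane_pt u v) - Dv ord0 (plane_pt u (- v)))))
  (fun u v => coef C (odd_part u v))
  (fun u v => coef C (- 2^-1 *: (g1 * (D0 (plane_pt u v) - D0 (plane_pt u (- v))))))
  (fun u v => coef C (- 2^-1 *: (g1 * (Dv ord0 (plane_pt u v) + Dv ord0 (plane_pt u (- v)))))).
Proof.
have lC : cl_linear (@coef R m.+1 C) := @cl_linear_coefE R m.+1 C.
split; [exact: planar_even|exact: planar_odd| | |].
- move=> u v ur vr; have [->|v0] := eqVneq v 0.
    by rewrite oppr0 !subrr mulr0 !scaler0 (cl_linear0 lC) addr0.
  have vr' : `|- v| < rho by rewrite normrN.
  have E1 := cauchy_riemann_plane ur vr (introT orP (or_introl v0)).
  have E2 : D0 (plane_pt u (- v)) + g1 * Dv ord0 (plane_pt u (- v)) =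
      (m%:R / v) *: odd_part u v.
    rewrite cauchy_riemann_plane ?oppr_eq0 ?v0 //.
    by rewrite odd_partN invrN mulrN scalerN scaleNr opprK.
  rewrite -(cl_linearD lC) scaleNr -scalerBr.
  suff -> : g1 * (D0 (plane_pt u v) - D0 (plane_pt u (- v))) =
      Dv ord0 (plane_pt u v) - Dv ord0 (plane_pt u (- v)).
    by rewrite subrr scaler0 (cl_linear0 lC).
  have -> : D0 (plane_pt u v) - D0 (plane_pt u (- v)) =
      - (g1 * (Dv ord0 (plane_pt u v) - Dv ord0 (plane_pt u (- v)))).
    rewrite mulrBr opprB; apply: (addIr (g1 * Dv ord0 (plane_pt u v))).
    by rewrite addrAC E1 -E2 addrAC subrr add0r subrK.
  by rewrite mulrN mulrA g1_sq mulN1r opprK.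
- move=> u v ur vr vm.
  have vr' : `|- v| < rho by rewrite normrN.
  have E1 := cauchy_riemann_plane ur vr vm.
  have E2 : D0 (plane_pt u (- v)) + g1 * Dv ord0 (plane_pt u (- v)) =
      (m%:R / v) *: odd_part u v.
    rewrite cauchy_riemann_plane ?oppr_eq0 //.
    by rewrite odd_partN invrN mulrN scalerN scaleNr opprK.
  rewrite -(cl_linearN lC) -(cl_linearD lC) scaleNr opprK -scalerDr mulrDr addrACA E1 E2.
  by rewrite -(cl_linearZ lC) -scalerDl scalerA; congr (coef C (_ *: _)); move: (_ / v) => c; field.
- by move=> u _; rewrite odd_part0 (cl_linear0 lC).
Qed.

End AxialPlane.

(** * The expansion *)

Section Assembly.
Variable R : realType.

Lemma enorm_pt n (u : R) (w : 'rV[R]_n) :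
  enorm (pt u w) ^+ 2 = u ^+ 2 + enorm w ^+ 2.
Proof.
rewrite !enorm_sq big_split_ord /= big_ord1 /pt; congr (_ ^+ 2 + _).
  by rewrite row_mxEl mxE eqxx.
by apply: eq_bigr => i _; rewrite row_mxEr.
Qed.

Lemma near0_enorm n (e : R) : 0 < e -> \forall x \near (0 : 'rV[R]_n), enorm x < e.
Proof.
move=> e0; have c : {for 0, continuous (@enorm R n)}.
  have cs : continuous (fun x : 'rV[R]_n => \sum_i x ord0 i ^+ 2).
    apply: continuous_big; first exact: add_continuous.
    move=> i _ x; have ci := @coord_continuous R 1 n ord0 i x.
    exact: (continuous_comp ci (@exprn_continuous R 2 _)).
  exact: (continuous_comp (cs 0) (@sqrt_continuous R _)).
apply: cvgr_lt c _ _.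
by rewrite /enorm big1 ?sqrtr0 // => i _; rewrite mxE expr0n.
Qed.

Lemma polar_exists (u v : R) : 0 <= v -> exists r t : R,
  [/\ 0 <= r, 0 <= t <= pi, u = r * cos t, v = r * sin t & r ^+ 2 = u ^+ 2 + v ^+ 2].
Proof.
move=> v0; pose r := Num.sqrt (u ^+ 2 + v ^+ 2).
have r2 : r ^+ 2 = u ^+ 2 + v ^+ 2 by rewrite sqr_sqrtr // addr_ge0 ?sqr_ge0.
have r0 : 0 <= r by exact: sqrtr_ge0.
have [rz|rz] := eqVneq r 0.
  have : u ^+ 2 + v ^+ 2 = 0 by rewrite -r2 rz expr0n.
  move/eqP; rewrite paddr_eq0 ?sqr_ge0 // !sqrf_eq0 => /andP[/eqP uz /eqP vz].
  by exists 0, 0; rewrite !mul0r lexx pi_ge0 uz vz expr0n addr0.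
have rp : 0 < r by rewrite lt_neqAle eq_sym rz r0.
have uI : -1 <= u / r <= 1.
  rewrite -ler_norml normrM normfV (gtr0_norm rp) ler_pdivrMr // mul1r.
  by rewrite -sqrtr_sqr ler_sqrt ?addr_ge0 ?sqr_ge0 // lerDl sqr_ge0.
exists r, (acos (u / r)); split => //.
- by rewrite acos_ge0 // acos_lepi.
- by rewrite acosK ?in_itv // mulrC divfK.
rewrite sin_acos // -{1}(gtr0_norm rp) -sqrtr_sqr -sqrtrM ?sqr_ge0 //.
have -> : r ^+ 2 * (1 - (u / r) ^+ 2) = r ^+ 2 - u ^+ 2 by field.
by rewrite r2 addrAC subrr add0r sqrtr_sqr ger0_norm.
Qed.

(** The partial sums are a fixed finite combination, over the blades, of scalar partial sums, so
    convergence is checked coordinate by coordinate. *)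
Lemma clifford_appell_series m (I : 'rV[R]_m.+1) (r t : R) (d : nat -> clifford R m.+1)
    (x y : clifford R m.+1) : sphere I ->
  (forall C, series (fun k => coef C (d k) * r ^+ k * appell_cos m k t) @ \oo --> coef C x) ->
  (forall C, series (fun k => coef C (d k) * r ^+ k * appell_sin m k t) @ \oo --> coef C y) ->
  series (fun k => clifford_appell k (pt (r * cos t) ((r * sin t) *: I)) * d k) @ \oo -->
    x + cl_vec I * y.
Proof.
move=> SI dx dy.
have -> : series (fun k => clifford_appell k (pt (r * cos t) ((r * sin t) *: I)) * d k) =
    (fun N => \sum_C (series (fun k => coef C (d k) * r ^+ k * appell_cos m k t) N *: blade R C +
      series (fun k => coef C (d k) * r ^+ k * appell_sin m k t) N *: (cl_vec I * blade R C))).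
  apply/funext => N; rewrite /series /=.
  under [RHS]eq_bigr do rewrite !scaler_suml -big_split.
  rewrite [RHS]exchange_big; apply: eq_bigr => k _ /=.
  rewrite clifford_appell_polar // {1}(cl_sumE (d k)) mulr_sumr.
  apply: eq_bigr => C _.
  rewrite -scalerAl mulrDl -!scalerAl mul1r -!scalerAr scalerDr !scalerA.
  by congr (_ *: _ + _ *: _); rewrite /GRing.scale /=; ring.
have -> : x + cl_vec I * y =
    \sum_C (coef C x *: blade R C + coef C y *: (cl_vec I * blade R C)).
  rewrite big_split /= -cl_sumE; congr (_ + _); rewrite {1}(cl_sumE y) mulr_sumr.
  by apply: eq_bigr => C _; rewrite -scalerAr.
apply: cvg_big; first exact: add_continuous.
by move=> C _; apply: cvgD; apply: cvgZr_tmp; [exact: dx|exact: dy].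
Qed.

Theorem axial_expansion m (U : set 'rV[R]_(1 + m.+1))
    (f : 'rV[R]_(1 + m.+1) -> clifford R m.+1) : U 0 -> axially_monogenic U f ->
  exists (d : nat -> clifford R m.+1) (e : R), [/\ 0 < e,
    forall C, exists M K : R, 0 < K /\ forall k, `|coef C (d k)| <= M * K ^+ k &
    forall x, enorm x < e -> series (fun k => clifford_appell k x * d k) @ \oo --> f x].
Proof.
move=> U0 f_axial; have [[[oU _] _ _ _] _ _] := f_axial.
have [rho rho0 rhoU] := nbhs_pt (open_nbhs_nbhs (conj oU U0)).
have H C := vekua_expansion rho0 (vekua_coef f_axial rhoU C).
have /choice[c Hc] := H.
have /choice[M HM] := Hc.
have /choice[K HK] := HM.
have /choice[e He] := HK.
pose d k : clifford R m.+1 := \row_i c (enum_val i) k.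
have dE C k : coef C (d k) = c C k by rewrite /coef mxE enum_rankK.
(* There are finitely many blades, so one radius serves all coordinates. *)
pose e0 := Num.min rho (\big[Num.min/1]_C e C).
exists d, e0; split.
- rewrite lt_min rho0 /=; apply: (big_ind (fun x => 0 < x)) => // [x y x0 y0|C _].
    by rewrite lt_min x0.
  by have [] := He C.
- move=> C; exists (M C), (K C); have [K0 _ cM _] := He C; split=> // k.
  by rewrite dE.
move=> x; rewrite lt_min => /andP[xrho xe].
pose v := enorm (vec x).
have v0 : 0 <= v := enorm_ge0 _.
have [r [t [r0 tI ur vr r2]]] := polar_exists (re x) v0.
have rx : r = enorm x.
  apply/eqP; rewrite -(@eqrXn2 _ 2%N) ?enorm_ge0 //.
  by rewrite r2 -[in X in _ == X](pt_re_vec x) enorm_pt.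
have [I SI xI] : exists2 I, sphere I & vec x = v *: I.
  have [vz|vz] := eqVneq v 0; last first.
    exists (v^-1 *: vec x); last by rewrite scalerA divff // scale1r.
    by apply: sphere_normalize; rewrite lt_neqAle eq_sym vz.
  (* At a real point the direction is arbitrary. *)
  exists (delta_mx ord0 ord0); first exact: sphere_delta.
  rewrite vz scale0r; apply/rowP => i; rewrite [RHS]mxE; apply/eqP.
  by rewrite -normr_le0 -vz coord_le_enorm.
have ux : `|re x| < rho.
  apply: le_lt_trans xrho; rewrite -rx ur normrM (ger0_norm r0).
  by rewrite ler_piMr // cos_max.
have vx : 0 <= v < rho.
  rewrite v0 (le_lt_trans _ xrho) // -rx vr ler_piMr // sin_le1 //.
have -> : f x = even_part f (re x) v + cl_vec I * odd_part f (re x) v.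
  by rewrite -(axial_formula f_axial rhoU SI ux vx) -xI pt_re_vec.
have xE : x = pt (r * cos t) ((r * sin t) *: I) by rewrite -ur -vr -xI pt_re_vec.
rewrite [in X in series X]xE.
have re_lt C : 0 <= r < e C.
  rewrite r0 rx; apply: lt_le_trans xe _; exact: bigmin_le_cond.
apply: clifford_appell_series => // C.
  have [_ _ _ /(_ r t (re_lt C) tI)[+ _]] := He C.
  by rewrite /polar -ur -vr; under eq_fun do rewrite -dE.
have [_ _ _ /(_ r t (re_lt C) tI)[_ +]] := He C.
by rewrite /polar -ur -vr; under eq_fun do rewrite -dE.
Qed.

End Assembly.

(** [derive1n] is a total operator; the first conjunct guarantees that the coefficients in the
    second are genuine iterated derivatives and not default values. *)
Theorem theorem3p5 (R : realType) (n : nat) (n_gt0 : (0 < n)%N)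
    (U : set 'rV[R]_(1 + n)) (f : 'rV[R]_(1 + n) -> clifford R n)
    (U0 : U 0) (f_axial : axially_monogenic U f) :
  (forall k : nat, \forall t \near (0 : R),
     derivable (derive1n k (restr_real f)) t 1) /\
  (\forall x \near (0 : 'rV[R]_(1 + n)),
     series (fun k : nat =>
       clifford_appell k x * ((k`!%:R)^-1 *: derive1n k (restr_real f) 0)) @ \oo
     --> f x).
Proof.
case: n n_gt0 U f U0 f_axial => // m _ U f U0 f_axial.
have [d [e [e0 dM He]]] := axial_expansion U0 f_axial.
have dF (i : 'I_#|{set 'I_m.+1}|) : \forall t \near (0 : R),
    series (fun k => (d k : 'rV__) ord0 i * t ^+ k) @ \oo -->
    (restr_real f t : 'rV__) ord0 i.
  apply/nbhs_ballP; exists e => //= t; rewrite /ball /= sub0r normrN => te.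
  have enp : enorm (pt t (0 : 'rV[R]_m.+1)) < e.
    suff -> : enorm (pt t (0 : 'rV[R]_m.+1)) = `|t| by [].
    apply/eqP; rewrite -(@eqrXn2 _ 2%N) ?enorm_ge0 // enorm_pt.
    by rewrite real_normK ?num_real // enorm_sq big1 ?addr0 // => j _; rewrite mxE expr0n.
  have -> : series (fun k => (d k : 'rV__) ord0 i * t ^+ k) =
      (fun N => (series (fun k => clifford_appell k (pt t 0) * d k) N : 'rV__) ord0 i).
    apply/funext => N; rewrite /series /= summxE; apply: eq_bigr => k _.
    by rewrite clifford_appell_real -scalerAl mul1r mxE mulrC.
  exact: (continuous_cvg _ (@coord_continuous R 1 _ ord0 i _) (He _ enp)).
have dM' (i : 'I_#|{set 'I_m.+1}|) : exists M K : R, 0 < K /\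
    forall k, `|(d k : 'rV__) ord0 i| <= M * K ^+ k.
  have [M [K [K0 H]]] := dM (enum_val i); exists M, K; split=> // k.
  by have := H k; rewrite /coef enum_valK.
have D k := derive1n_pseries k dM' dF.
split=> [k|]; first by have [] := D k.
apply: filterS (near0_enorm _ e0) => x /He.
have -> // : (fun k => clifford_appell k x * d k) =
  (fun k => clifford_appell k x * ((k`!%:R)^-1 *: derive1n k (restr_real f) 0)).
apply/funext => k; have [_ ->] := D k.
by rewrite scalerA mulVf ?scale1r // pnatr_eq0 -lt0n fact_gt0.
Qed.
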